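(* Let $r\ge 2$ be an integer, let $J$ be a finite nonempty set, and let $(\varphi^{(j)})_{j\in J}$ be polynomial probability densities with respect to the standard normal distribution $\mu$, each having moments of orders $1,\dots,r$ equal to those of $\mu$ and each satisfying Hypothesis (H) of the context (with $K=r+1$). Let $(X_i)_{i\ge1}$ be independent real random variables such that for every $i$ the law of $X_i$ has density $\varphi^{(j)}$ with respect to $\mu$ for some $j=j(i)\in J$. For $n\ge 1$ let $f_n$ be the density with respect to $\mu$ of $Y_n:=\frac1{\sqrt n}\sum_{i=1}^nX_i$. Then $$\limsup_{n\to+\infty}\; n^{\frac{r-1}{2}}\,\chi_2(f_n)<+\infty .$$
   Context: $\mu$ is the standard normal distribution on $\mathbb{R}$. For a probability density $f\in L^2(\mu)$ with respect to $\mu$ (i.e. $f\ge 0$, $\int f\,d\mu=1$), $\chi_2(f):=\left(\int (f-1)^2\,d\mu\right)^{1/2}$. Normalized Hermite polynomials: $\bar H_n(x)=\frac{(-1)^n}{\sqrt{n!}}e^{x^2/2}D^n(e^{-x^2/2})$ for $n\ge 0$ (with $D=d/dx$); they form an orthonormal basis of $L^2(\mu)$, and $g_k:=\int g\bar H_k\,d\mu$ denotes the $k$-th coefficient of $g\in L^2(\mu)$. Hypothesis (H). Let $r\ge 1$, $K:=r+1$, and let $\varphi$ be a polynomial probability density with respect to $\mu$ whose moments of orders $1,\dots,r$ equal those of $\mu$. Then either $\varphi=1$, or $\varphi=1+\sum_{k=K}^N\varphi_k\bar H_k$ with $N=\deg\varphi\ge K$. If $\varphi=1$, Hypothesis (H)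 holds by convention. Otherwise put $$C_k:=\left(1+\frac NK\right)^{k/2},\qquad \gamma_k:=\frac{1}{\sqrt{k!}}\,C_k|\varphi_k| ,$$ and (H) means that all of the following hold (with the convention $x^0=1$ for any base $x$): (H1) if $K\le N-2$, then $(k+2)\gamma_{k+2}\le\gamma_k$ for all $K\le k\le N-2$; (H2a) if $K\le N-1$, then $$\max\left\{\left(\frac{2(K+1)\gamma_{K+1}}{N}\right)^N\left(\frac{K-1}{2\gamma_N}\right)^{K-1},\ \left(\frac{2K\gamma_K}{N-1}\right)^{N-1}\left(\frac{K-2}{2\gamma_{N-1}}\right)^{K-2}\right\}\le\frac{1}{(N-K+1)^{N-K+1}},$$ where, if $K\ge 3$, it is part of the condition that $\gamma_{N-1}\ne 0$ so that the quotient makes sense; (H2b) if $K=N$, then $\gamma_N\le\frac{1}{2(N-2)^{(N-2)/2}}$. *)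

(* Defs.v *)
From HB Require Import structures.
From mathcomp Require Import all_boot all_order all_algebra finmap.
From mathcomp Require Import all_classical all_reals all_analysis.

Set Implicit Arguments.
Unset Strict Implicit.
Unset Printing Implicit Defensive.

Import Order.TTheory GRing.Theory Num.Theory.
Import numFieldTopology.Exports numFieldNormedType.Exports.

Local Open Scope classical_set_scope.
Local Open Scope ring_scope.

Definition std_normal (R : realType) : probability (measurableTypeR R) R :=
  normal_prob (0 : R) 1.

Section density.
Context {R : realType}.
Local Notation mu := (std_normal R).

Definition prob_density (f : R -> R) : Prop :=
  [/\ measurable_fun setT f, (forall x, 0 <= f x)
    & (\int[mu]_x (f x)%:E = 1)%E].

Definition has_density d (T : measurableType d) (P : probability T R)
    (Y : T -> R) (f : R -> R) : Prop :=
  forall A : set R, measurable A ->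
    (P (Y @^-1` A) = \int[mu]_(x in A) (f x)%:E)%E.

(* Extended-real valued: [chi2 f] is +oo when f is not in L^2(mu). *)
Definition chi2 (f : R -> R) : \bar R :=
  ((\int[mu]_x ((f x - 1) ^+ 2)%:E) `^ (2^-1))%E.

Definition same_moments (r : nat) (f : R -> R) : Prop :=
  forall m : nat, (1 <= m <= r)%N ->
    (\int[mu]_x (x ^+ m * f x)%:E = \int[mu]_x (x ^+ m)%:E)%E.

Definition hermite (n : nat) (x : R) : R :=
  (-1) ^+ n / Num.sqrt (n`!)%:R * expR (x ^+ 2 / 2) *
  derive1n n (fun y : R => expR (- (y ^+ 2 / 2))) x.

Definition hermite_coef (g : R -> R) (k : nat) : R :=
  \int[mu]_x (g x * hermite k x).

End density.

Section hypothesis_H.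
Context {R : realType}.
Variables (K : nat) (phi : {poly R}).

Local Notation N := (size phi).-1.

Definition Hcst (k : nat) : R := (1 + N%:R / K%:R) `^ (k%:R / 2).

Definition Hgamma (k : nat) : R :=
  (Num.sqrt (k`!)%:R)^-1 * Hcst k * `|hermite_coef (horner phi) k|.

Definition H1 : Prop :=
  forall k : nat, (K <= k)%N -> (k.+2 <= N)%N ->
    k.+2%:R * Hgamma k.+2 <= Hgamma k.

(* The convention x^0 = 1 (any x) agrees with [^+]: for K = 2 the factor
   ((K - 2) / (2 gamma_(N-1)))^(K - 2) is 1 whatever gamma_(N-1) is. *)
Definition H2a : Prop :=
  (K < N)%N ->
  ((3 <= K)%N -> Hgamma N.-1 != 0) /\
  Num.max
    ((2 * K.+1%:R * Hgamma K.+1 / N%:R) ^+ N *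
     (K.-1%:R / (2 * Hgamma N)) ^+ K.-1)
    ((2 * K%:R * Hgamma K / N.-1%:R) ^+ N.-1 *
     (K.-2%:R / (2 * Hgamma N.-1)) ^+ K.-2)
  <= 1 / (N - K).+1%:R ^+ (N - K).+1.

(* N = K >= 2; for N = 2 the real power is 0 `^ 0 = 1. *)
Definition H2b : Prop :=
  K = N -> Hgamma N <= 1 / (2 * (N - 2)%:R `^ ((N - 2)%:R / 2)).

Definition hypothesis_H : Prop := phi = 1 \/ [/\ H1, H2a & H2b].

End hypothesis_H.

Definition mutually_independent (R : realType) d (T : measurableType d)
    (P : probability T R) (I : choiceType) (X : I -> {RV P >-> R}) : Prop :=
  forall (s : {fset I}) (B : I -> set R), (forall i, measurable (B i)) ->
    (P (\bigcap_(i in [set` s]) (X i @^-1` B i)) =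
     \prod_(i <- s) P (X i @^-1` B i))%E.

(* The sequence is indexed from 0: [X i] is the (i+1)-st variable. *)
Definition normalized_sum (R : realType) (T : Type) (X : nat -> T -> R)
    (n : nat) (t : T) : R :=
  (Num.sqrt n%:R)^-1 * \sum_(i < n) X i t.

(* Main.v *)
Require Import Defs.
From HB Require Import structures.
From mathcomp Require Import all_boot all_order all_algebra finmap.
From mathcomp Require Import all_classical all_reals all_analysis.
From mathcomp Require Import measurable_realfun ring lra zify.

(* A polynomial density [phi] is encoded by the polynomial [g] with
   [phi = sum_k g_k He_k], that is [g_k = phi_k / sqrt k!]; equivalently
   [g t = int phi (x + t) dmu x].  By rotation invariance of [mu x mu], the density
   of [a Y + b X] (with [a ^ 2 + b ^ 2 = 1], [Y] and [X] independent) is encoded by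
   [p (a t) q (b t)], so the density of [Y_n] is encoded by
   [prod_i g_i (t / sqrt n)], and by Parseval
   [chi_2 ^ 2 = sum_(m >= 1) m! n ^ (- m) c_m ^ 2] with [c_m] the coefficients of
   [prod_i g_i].

   Hypothesis (H) says, via weighted AM-GM, that [G' t <= t G t] for
   [G t = 1 + sum_k gamma_k t ^ k] and [t >= 0], hence [G t <= exp (t ^ 2 / 2)].  As
   [gamma_k = (1 + N / K) ^ (k / 2) |g_k|] and [N >= K], the majorant
   [B t = sum_k |g_k| t ^ k] satisfies [B t <= exp (t ^ 2 / 4)].  Telescoping gives
   [prod_i B_i t - 1 <= n M t ^ K exp (n t ^ 2 / 4)], and evaluating at
   [t ^ 2 = 2 m / n] bounds [m! n ^ (- m) c_m ^ 2] by [n ^ (2 - K)] times a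
   summable sequence in [m]. *)

Set Implicit Arguments.
Unset Strict Implicit.
Unset Printing Implicit Defensive.

Import Order.TTheory GRing.Theory Num.Theory.
Import numFieldTopology.Exports numFieldNormedType.Exports.

Local Open Scope classical_set_scope.
Local Open Scope ring_scope.

(** * Hermite expansions of polynomials *)

Section gaussian_mean.
Context {R : numFieldType}.
Implicit Types (p q P Q : {poly R}) (k l n : nat).

(** Moments of the standard normal law, given by the recursion that integration by parts produces;
    [moment] identifies them with integrals. *)
Fixpoint gmoment n : R :=
  match n with
  | 0 => 1
  | 1 => 0
  | m.+2 => m.+1%:R * gmoment m
  end.

(** Gaussian expectation of a polynomial, kept algebraic so that the Hermite calculus involves no
    integral; [integral_horner] makes the link. *)
Definition gmean p : R := \sum_(i < size p) p`_i * gmoment i.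

Lemma gmean_wide n p : (size p <= n)%N -> gmean p = \sum_(i < n) p`_i * gmoment i.
Proof.
move=> pn; rewrite /gmean (big_ord_widen n (fun i => p`_i * gmoment i) pn).
rewrite [RHS](bigID (fun i : 'I_n => (i < size p)%N)) /= [X in _ + X]big1 ?addr0 //.
by move=> i; rewrite -leqNgt => /leq_sizeP/(_ _ (leqnn _)) ->; rewrite mul0r.
Qed.

Fact gmean_is_linear : linear_for *%R gmean.
Proof.
move=> a p q; pose n := maxn (size (a *: p + q)) (maxn (size p) (size q)).
rewrite (@gmean_wide n) ?leq_maxl // (@gmean_wide n p) ?(@gmean_wide n q);
  rewrite ?leq_max ?leqnn ?orbT //.
rewrite mulr_sumr -big_split; apply: eq_bigr => i _ /=.
by rewrite coefD coefZ mulrDl mulrA.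
Qed.

HB.instance Definition _ :=
  GRing.isLinear.Build R {poly R} R *%R gmean gmean_is_linear.

Lemma gmeanZ a p : gmean (a *: p) = a * gmean p.
Proof. exact: scalarZ. Qed.

Lemma gmeanD p q : gmean (p + q) = gmean p + gmean q.
Proof. exact: raddfD. Qed.

Lemma gmeanB p q : gmean (p - q) = gmean p - gmean q.
Proof. exact: raddfB. Qed.

Lemma gmean_sum (I : Type) (r : seq I) (D : pred I) (F : I -> {poly R}) :
  gmean (\sum_(i <- r | D i) F i) = \sum_(i <- r | D i) gmean (F i).
Proof. exact: raddf_sum. Qed.

Lemma gmean1 : gmean 1 = 1.
Proof. by rewrite /gmean size_poly1 big_ord1 coefC mulr1. Qed.

Lemma gmeanXn n : gmean 'X^n = gmoment n.
Proof.
rewrite /gmean size_polyXn (bigD1 ord_max) //= coefXn eqxx mul1r big1 ?addr0 //.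
move=> i; rewrite -val_eqE /= => /negPf ne; rewrite coefXn ne mul0r //.
Qed.

(** Gaussian integration by parts: on monomials it is the recursion of [gmoment], and both sides are
    linear in [p]. *)
Lemma gmeanX p : gmean ('X * p) = gmean p^`().
Proof.
have mono n : gmean ('X * 'X^n) = gmean ('X^n)^`().
  case: n => [|n]; rewrite -exprS gmeanXn derivXn /=; first by rewrite mulr0n raddf0.
  by rewrite raddfMn /= gmeanXn mulr_natl.
rewrite -[p]coefK poly_def (big_morph _ (@derivD R) (deriv0 R)) mulr_sumr.
rewrite !gmean_sum; apply: eq_bigr => i _.
by rewrite derivZ -scalerAr !gmeanZ mono.
Qed.

(** Unnormalized monic Hermite polynomials, built with the creation operator, which is the adjoint
    of differentiation for [gmean]. *)
Fixpoint herm k : {poly R} :=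
  if k is l.+1 then 'X * herm l - (herm l)^`() else 1.

Lemma deriv_herm k : (herm k.+1)^`() = k.+1%:R *: herm k.
Proof.
elim: k => [|k IH].
  by rewrite /= -[1]polyC1 derivC subr0 mulr1 derivX scale1r.
rewrite [herm k.+2]/= derivB derivM derivX mul1r.
rewrite -/(herm k.+1) IH -scalerAr derivZ -addrA -scalerBr -/(herm k.+1).
by rewrite -{1}[herm k.+1]scale1r -scalerDl nat1r.
Qed.

Lemma deriv_herm_pred k : (herm k)^`() = k%:R *: herm k.-1.
Proof. by case: k => [|k]; rewrite ?deriv_herm // scale0r /= -polyC1 derivC. Qed.

Lemma hermS k : herm k.+1 = 'X * herm k - k%:R *: herm k.-1.
Proof. by rewrite -deriv_herm_pred. Qed.

Lemma herm_monic_size k : herm k \is monic /\ size (herm k) = k.+1.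
Proof.
elim: k => [|k [mk sk]]; first by rewrite monic1 size_poly1.
have s1 : size ('X * herm k) = k.+2.
  by rewrite -commr_polyX size_mulX ?sk // monic_neq0.
have lt : (size (- (herm k)^`()) < size ('X * herm k)%R)%N.
  by rewrite size_polyN s1 (ltn_trans (lt_size_deriv _)) ?monic_neq0 // sk.
rewrite /= /monic qualifE /= lead_coefDl // size_polyDl //.
by rewrite lead_coefM lead_coefX mul1r (monicP mk) eqxx.
Qed.

(** Each application of the creation operator in [herm k] moves onto [p] as one derivative. *)
Lemma gmean_herm k p : gmean (herm k * p) = gmean p^`(k).
Proof.
elim: k p => [|k IH] p; first by rewrite mul1r.
rewrite /= mulrBl -mulrA gmeanB gmeanX derivM gmeanD addrAC subrr add0r.
by rewrite IH -derivSn derivnS.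
Qed.

(** Orthogonality: with [l <= k], differentiating [herm l] [k] times gives 0 if [l < k] and the
    constant [k!] if [l = k]. *)
Lemma gmean_herm2 k l : gmean (herm k * herm l) = (k == l)%:R * k`!%:R.
Proof.
wlog kl : k l / (l <= k)%N.
  move=> H; have [/H//|/ltnW/H] := leqP l k.
  rewrite mulrC => ->; rewrite eq_sym; case: eqP => [->//|_]; by rewrite !mul0r.
rewrite gmean_herm; have [ml sl] := herm_monic_size l.
move: kl; rewrite leq_eqVlt => /predU1P[<-|lk]; last first.
  rewrite (gtn_eqF lk) mul0r derivn_poly0 ?raddf0 // sl //.
rewrite eqxx mul1r.
have {sl}: size (herm l) = l.+1 by [].
elim: l {ml} => [|l IH] _; first by rewrite /= gmean1.
by rewrite derivSn deriv_herm derivnZ /= gmeanZ IH ?factS ?natrM // (herm_monic_size l).2.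
Qed.

(* The inverse of the heat semigroup at time 1 on polynomials. *)
Definition hexp P : {poly R} := \sum_(i < size P) P`_i *: herm i.

Lemma hexp_wide n P : (size P <= n)%N -> hexp P = \sum_(i < n) P`_i *: herm i.
Proof.
move=> pn; rewrite /hexp (big_ord_widen n (fun i => P`_i *: herm i) pn).
rewrite [RHS](bigID (fun i : 'I_n => (i < size P)%N)) /= [X in _ + X]big1 ?addr0 //.
by move=> i; rewrite -leqNgt => /leq_sizeP/(_ _ (leqnn _)) ->; rewrite scale0r.
Qed.

Fact hexp_is_linear : linear hexp.
Proof.
move=> a p q; pose n := maxn (size (a *: p + q)) (maxn (size p) (size q)).
rewrite (@hexp_wide n) ?leq_maxl // (@hexp_wide n p) ?(@hexp_wide n q);
  rewrite ?leq_max ?leqnn ?orbT //.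
rewrite scaler_sumr -big_split; apply: eq_bigr => i _ /=.
by rewrite coefD coefZ scalerDl scalerA.
Qed.

HB.instance Definition _ :=
  GRing.isLinear.Build R {poly R} {poly R} *:%R hexp hexp_is_linear.

Lemma hexpXn n : hexp 'X^n = herm n.
Proof.
rewrite /hexp size_polyXn (bigD1 ord_max) //= coefXn eqxx scale1r big1 ?addr0 //.
move=> i; rewrite -val_eqE /= => /negPf ne; rewrite coefXn ne scale0r //.
Qed.

Lemma hexp1 : hexp 1 = 1.
Proof. by rewrite -(expr0 'X) hexpXn. Qed.

(** Since [herm k] is monic of degree [k], subtracting a multiple of it lowers the degree. The size
    is tracked because Hypothesis (H) refers to the degree [N]. *)
Lemma hexp_surj p : exists2 P : {poly R}, size P = size p & hexp P = p.
Proof.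
have [n] := ubnP (size p); elim: n p => // n IH p; rewrite ltnS => sp.
have [->|p0] := eqVneq p 0; first by exists 0; rewrite ?raddf0.
pose k := (size p).-1; have sk : size p = k.+1 by rewrite prednK // lt0n size_poly_eq0.
have [mk shk] := herm_monic_size k.
pose q := p - lead_coef p *: herm k.
have sq : (size q < size p)%N.
  rewrite sk ltnS; apply/leq_sizeP => j; rewrite leq_eqVlt => /predU1P[<-|kj].
    rewrite coefB coefZ lead_coefE -/k; move/monicP: mk; rewrite lead_coefE shk /= => ->.
    by rewrite mulr1 subrr.
  by rewrite coefB coefZ !nth_default ?shk ?sk // mulr0 subrr.
have [Q sQ hQ] := IH q (leq_trans sq sp).
exists (lead_coef p *: 'X^k + Q); last first.
  by rewrite linearP /= hexpXn hQ /q addrC subrK.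
have sX : size (lead_coef p *: 'X^k) = k.+1.
  by rewrite size_scale ?lead_coef_eq0 // size_polyXn.
by rewrite size_polyDl ?sX // sQ -sk.
Qed.

Lemma gmean_hermh k P : gmean (herm k * hexp P) = k`!%:R * P`_k.
Proof.
have [kP|Pk] := ltnP k (size P); last first.
  rewrite nth_default // mulr0 /hexp mulr_sumr gmean_sum big1 // => i _.
  rewrite -scalerAr gmeanZ gmean_herm2 gtn_eqF ?mul0r ?mulr0 //.
  exact: leq_trans (ltn_ord i) Pk.
rewrite /hexp mulr_sumr gmean_sum (bigD1 (Ordinal kP)) //= big1 ?addr0.
  by rewrite -scalerAr gmeanZ gmean_herm2 eqxx mul1r mulrC.
move=> i; rewrite -val_eqE /= eq_sym => /negPf ne.
by rewrite -scalerAr gmeanZ gmean_herm2 ne mul0r mulr0.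
Qed.

(** Parseval's identity; the weight [i!] is the squared norm of [herm i]. *)
Lemma gmean_hexp2 P Q : gmean (hexp P * hexp Q) = \sum_(i < size P) i`!%:R * (P`_i * Q`_i).
Proof.
rewrite /hexp mulr_suml gmean_sum; apply: eq_bigr => i _ /=.
rewrite -scalerAl gmeanZ -/(hexp Q) gmean_hermh; ring.
Qed.

(** Through [hexp], and for [|a| <= 1], this is the Ornstein-Uhlenbeck action, which multiplies the
    Hermite coefficient of order [i] by [a ^+ i]. *)
Definition pdilate a P : {poly R} := P \Po (a *: 'X).

Lemma coef_pdilate a P i : (pdilate a P)`_i = a ^+ i * P`_i.
Proof.
rewrite /pdilate comp_polyE coef_sum.
under eq_bigr => j _ do rewrite exprZn coefZ coefZ coefXn.
have [iP|Pi] := ltnP i (size P).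
  rewrite (bigD1 (Ordinal iP)) //= eqxx mulr1 big1 ?addr0 1?mulrC //.
  by move=> j; rewrite -val_eqE /= eq_sym => /negPf ->; rewrite !mulr0.
rewrite [P`_i]nth_default // mulr0 big1 // => j _.
by rewrite gtn_eqF ?mulr0 // (leq_trans (ltn_ord j)).
Qed.

Lemma pdilateM a P Q : pdilate a (P * Q) = pdilate a P * pdilate a Q.
Proof. exact: comp_polyM. Qed.

Lemma pdilate_dilate a b P : pdilate a (pdilate b P) = pdilate (a * b) P.
Proof. by apply/polyP => i; rewrite !coef_pdilate exprMn; ring. Qed.

Lemma horner_pdilate a P x : (pdilate a P).[x] = P.[a * x].
Proof. by rewrite horner_comp hornerZ hornerX. Qed.


Lemma deriv_affine c b p : (p \Po (c%:P + b *: 'X))^`() = b *: (p^`() \Po (c%:P + b *: 'X)).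
Proof. by rewrite deriv_comp derivD derivC derivZ derivX add0r mulrC -scalerAl mul1r. Qed.

(** The three-term recurrence lowers an index, Gaussian integration by parts in the averaged
    variable removes the factor [u] or [v], and [a ^+ 2 + b ^+ 2 = 1] merges the lower-order terms
    into the recurrence for [herm (k + l)]. *)
Lemma gmean_rot_herm a b z k l : a ^+ 2 + b ^+ 2 = 1 ->
  gmean ((herm k \Po ((a * z)%:P + b *: 'X)) * (herm l \Po ((b * z)%:P + (- a) *: 'X)))
  = a ^+ k * b ^+ l * (herm (k + l)).[z].
Proof.
move=> ab.
set u := _ + b *: 'X; set v := _ + _ *: 'X.
have Du i : (herm i \Po u)^`() = (b * i%:R) *: (herm i.-1 \Po u).
  by rewrite deriv_affine deriv_herm_pred comp_polyZ scalerA.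
have Dv i : (herm i \Po v)^`() = (- a * i%:R) *: (herm i.-1 \Po v).
  by rewrite deriv_affine deriv_herm_pred comp_polyZ scalerA.
have h0 w : herm 0 \Po w = 1 by rewrite /= -polyC1 comp_polyC.
have hz m : (herm m.+1).[z] = z * (herm m).[z] - m%:R * (herm m.-1).[z].
  by rewrite hermS !hornerE.
have hS w i : herm i.+1 \Po w = w * (herm i \Po w) - i%:R *: (herm i.-1 \Po w).
  by rewrite hermS comp_polyB comp_polyM comp_polyX comp_polyZ.
have uE (w : {poly R}) : gmean (u * w) = a * z * gmean w + b * gmean w^`().
  by rewrite mulrDl mul_polyC -scalerAl gmeanD !gmeanZ gmeanX.
have vE (w : {poly R}) : gmean (v * w) = b * z * gmean w - a * gmean w^`().
  by rewrite mulrDl mul_polyC -scalerAl gmeanD !gmeanZ gmeanX mulNr.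
have b2 : b ^+ 2 = 1 - a ^+ 2 by rewrite -ab; ring.
(* The outer induction is on [k]; its base case needs a separate induction on [l]. *)
elim/ltn_ind: k l => -[|k] IHk l.
  rewrite h0 mul1r expr0 mul1r add0n.
  elim/ltn_ind: l => -[|l] IHl; first by rewrite h0 gmean1 expr0 mul1r hornerC.
  rewrite hS gmeanB gmeanZ vE Dv gmeanZ IHl // hz.
  case: l IHl => [|l] IHl; first by rewrite !mul0r !mulr0; ring.
  rewrite /= IHl 1?ltnW //; have -> : b ^+ l.+2 = b ^+ l * (1 - a ^+ 2).
    by rewrite -b2 -exprD addn2.
  by rewrite exprS; ring: b2.
rewrite hS mulrBl gmeanB -[u * _ * _]mulrA uE derivM Du Dv -!(scalerAl _ (herm k.-1 \Po u)) -(scalerAr _ (herm k \Po u)) gmeanD !gmeanZ.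
rewrite IHk // addSn hz.
(* The factors [k%:R] and [l%:R] stay in front: at index 0 the truncated predecessor is meaningless
   and the zero factor makes both sides vanish. *)
have H1 : k%:R * gmean ((herm k.-1 \Po u) * (herm l \Po v)) =
   k%:R * (a ^+ k.-1 * b ^+ l * (herm (k + l).-1).[z]).
  case: k IHk => [|k] IHk; first by rewrite !mul0r.
  by rewrite /= IHk 1?ltnW.
have H2 : l%:R * gmean ((herm k \Po u) * (herm l.-1 \Po v)) =
   l%:R * (a ^+ k * b ^+ l.-1 * (herm (k + l).-1).[z]).
  case: l {H1} => [|l]; first by rewrite !mul0r.
  by rewrite /= IHk // addnS.
have -> : b * k%:R * gmean ((herm k.-1 \Po u) * (herm l \Po v)) +
    - a * l%:R * gmean ((herm k \Po u) * (herm l.-1 \Po v)) =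
   b * (k%:R * (a ^+ k.-1 * b ^+ l * (herm (k + l).-1).[z])) -
   a * (l%:R * (a ^+ k * b ^+ l.-1 * (herm (k + l).-1).[z])).
  by rewrite -H1 -H2; ring.
rewrite H1 natrD.
have E1 : k%:R * a ^+ k = k%:R * a ^+ k.-1 * a.
  by case: (k) => [|m]; [rewrite !mul0r|rewrite /= exprSr mulrA].
have E2 : l%:R * b ^+ l = l%:R * b ^+ l.-1 * b.
  by case: (l) => [|m]; [rewrite !mul0r|rewrite /= exprSr mulrA].
set h := (herm (k + l).-1).[z]; set h' := (herm _).[z]; rewrite exprS.
have -> : a * a ^+ k * b ^+ l * (z * h' - (k%:R + l%:R) * h) =
  a * a ^+ k * b ^+ l * z * h' - a * (k%:R * a ^+ k) * b ^+ l * h -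
  a * a ^+ k * (l%:R * b ^+ l) * h by ring.
rewrite E1 E2; ring: b2.
Qed.

(** Bilinear extension of [gmean_rot_herm]. The left side averages the product of the two densities
    over the line [a y + b x = z], which is how the density of [a Y + b X] at [z] arises. *)
Lemma gmean_rot a b z P Q : a ^+ 2 + b ^+ 2 = 1 ->
  gmean ((hexp P \Po ((a * z)%:P + b *: 'X)) * (hexp Q \Po ((b * z)%:P + (- a) *: 'X)))
  = (hexp (pdilate a P * pdilate b Q)).[z].
Proof.
move=> ab; have pd c S : pdilate c S = \sum_(i < size S) (c ^+ i * S`_i) *: 'X^i.
  rewrite /pdilate comp_polyE; apply: eq_bigr => i _.
  by rewrite exprZn scalerA mulrC.
have cs w S : hexp S \Po w = \sum_(i < size S) S`_i *: (herm i \Po w).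
  by rewrite /hexp raddf_sum /=; apply: eq_bigr => i _; rewrite comp_polyZ.
have hs (I : finType) (F : I -> {poly R}) : hexp (\sum_i F i) = \sum_i hexp (F i).
  exact: raddf_sum.
rewrite 2!pd !cs mulr_suml mulr_suml hs gmean_sum horner_sum.
apply: eq_bigr => i _; rewrite !mulr_sumr gmean_sum hs horner_sum.
apply: eq_bigr => j _; rewrite -!scalerAl -!scalerAr -exprD.
have hz c S : hexp (c *: S) = c *: hexp S by exact: linearZ.
rewrite !gmeanZ !hz hexpXn gmean_rot_herm // !hornerZ; ring.
Qed.

End gaussian_mean.

(** * Coefficients of products with Gaussian growth *)

Section coefficient_majorants.
Context {R : realType}.
Implicit Types (p q g : {poly R}) (t x : R).

Definition majorant p : {poly R} := \poly_(i < size p) `|p`_i|.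

Lemma coef_majorant p i : (majorant p)`_i = `|p`_i|.
Proof. by rewrite coef_poly; case: ltnP => // /leq_sizeP/(_ _ (leqnn _)) ->; rewrite normr0. Qed.

Lemma le_coef_prod n (F G : nat -> {poly R}) :
  (forall i k, `|(F i)`_k| <= (G i)`_k) ->
  forall k, `|(\prod_(i < n) F i)`_k| <= (\prod_(i < n) G i)`_k.
Proof.
move=> FG; elim: n => [|n IH] k.
  by rewrite !big_ord0 coef1; case: eqP; rewrite ?normr1 ?normr0.
rewrite !big_ord_recr /= !coefM (le_trans (ler_norm_sum _ _ _)) //.
by apply: ler_sum => i _; rewrite normrM ler_pM.
Qed.

(* Telescoping [prod B_i - 1 = sum_i (B_i - 1) prod_(l < i) B_l]. *)
Lemma prod_sub1_le n (B : nat -> R) (e d : R) :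
  (forall i, 1 <= B i) -> (forall i, B i <= e) -> (forall i, B i - 1 <= d * e) ->
  \prod_(i < n) B i - 1 <= n%:R * d * e ^+ n.
Proof.
move=> B1 Be Bd.
have e1 : 1 <= e := le_trans (B1 0) (Be 0).
have e0 : 0 <= e := le_trans ler01 e1.
have d0 : 0 <= d.
  have : 0 <= d * e by rewrite (le_trans _ (Bd 0)) // subr_ge0.
  by rewrite pmulr_lge0 // (lt_le_trans ltr01).
have Pe m : \prod_(i < m) B i <= e ^+ m.
  rewrite -[m in e ^+ m]card_ord -prodr_const; apply: ler_prod => i _.
  by rewrite Be (le_trans ler01).
elim: n => [|n IH]; first by rewrite big_ord0 subrr !mul0r.
rewrite big_ord_recr /=.
have -> : \prod_(i < n) B i * B n - 1 =
  \prod_(i < n) B i * (B n - 1) + (\prod_(i < n) B i - 1) by ring.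
have h1 : \prod_(i < n) B i * (B n - 1) <= d * e ^+ n.+1.
  rewrite exprS mulrA mulrC ler_pM ?subr_ge0 // prodr_ge0 // => i _.
  exact: le_trans ler01 (B1 _).
have h2 : n%:R * d * e ^+ n <= n%:R * d * e ^+ n.+1.
  by rewrite exprS ler_wpM2l ?mulr_ge0 // ler_peMl // exprn_ge0.
rewrite -natr1; lra.
Qed.

(** For [t <= 1] the summand 1 suffices; for [t > 1], [t ^+ k <= t ^+ (2 * k)], which one term of
    the exponential series controls. *)
Lemma le_pow_expR k (c t : R) : 0 < c -> 0 <= t ->
  t ^+ k <= (1 + k`!%:R / c ^+ k) * expR (c * t ^+ 2).
Proof.
move=> c0 t0; have ct0 : 0 <= c * t ^+ 2 by rewrite mulr_ge0 ?sqr_ge0 ?ltW.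
have e1 : 1 <= expR (c * t ^+ 2) by rewrite -expR0 ler_expR.
have h : (t ^+ 2) ^+ k <= k`!%:R / c ^+ k * expR (c * t ^+ 2).
  case: k => [|k]; first by rewrite !expr0 divr1 mul1r.
  have := expR_ge1Dxn k ct0; rewrite exprMn => h.
  have h' : c ^+ k.+1 * (t ^+ 2) ^+ k.+1 / k.+1`!%:R <= expR (c * t ^+ 2) by lra.
  rewrite ler_pdivrMr ?ltr0n ?fact_gt0 // in h'.
  by rewrite mulrAC ler_pdivlMr ?exprn_gt0 // mulrC [leRHS]mulrC.
rewrite mulrDl mul1r; have [t1|t1] := leP t 1.
  rewrite (le_trans (exprn_ile1 _ t0 t1)) // (le_trans e1) // lerDl.
  by rewrite (le_trans _ h) // exprn_ge0 // sqr_ge0.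
rewrite (le_trans _ (le_trans h _)) ?lerDr ?expR_ge0 // -exprM.
by rewrite ler_weXn2l ?ltW // leq_pmull.
Qed.

(** A Stirling-type upper bound on [n!], by induction from [e <= (1 + 1 / N) ^ (N + 1)]. *)
Lemma fact_le_expR n : n`!%:R * expR n%:R <= expR 1 * n.+1%:R * n%:R ^+ n :> R.
Proof.
case: n => [|n]; first by rewrite expR0 !mulr1 -expR0 ler_expR.
(* For positive indices the sharper prefactor [n] is proved, which is what the induction preserves;
   the successor in the statement covers [n = 0]. *)
suff H : n.+1`!%:R * expR n.+1%:R <= expR 1 * n.+1%:R * n.+1%:R ^+ n.+1 :> R.
  rewrite (le_trans H) // ler_wpM2r ?exprn_ge0 // ler_wpM2l ?expR_ge0 // ler_nat //.
elim: n => [|n IH]; first by rewrite expr1n !mulr1 mul1r.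
set N : R := n.+1%:R in IH *; have N0 : 0 < N by rewrite ltr0n.
have N1 : n.+2%:R = N + 1 :> R by rewrite -natr1.
have key : expR 1 * N ^+ n.+2 <= (N + 1) ^+ n.+2.
  have h : N / (N + 1) <= expR (- (N + 1)^-1).
    rewrite (le_trans _ (expR_ge1Dx _)) // le_eqVlt; apply/orP; left; apply/eqP.
    by field; rewrite lt0r_neq0 // addr_gt0.
  have : (N / (N + 1)) ^+ n.+2 <= expR (- (N + 1)^-1) ^+ n.+2.
    by rewrite lerXn2r ?nnegrE ?expR_ge0 ?divr_ge0 ?addr_ge0 // ltW.
  rewrite -expRM_natl N1 mulrN divff ?lt0r_neq0 ?addr_gt0 // expRN expr_div_n.
  rewrite ler_pdivrMr ?exprn_gt0 ?addr_gt0 // mulrC ler_pdivlMr ?expR_gt0 //.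
  by rewrite mulrC.
rewrite factS natrM N1 expRD.
have -> : (N + 1) * n.+1`!%:R * (expR N * expR 1) = (N + 1) * expR 1 * (n.+1`!%:R * expR N) by ring.
apply: (@le_trans _ _ ((N + 1) * expR 1 * (expR 1 * N * N ^+ n.+1))).
  by rewrite ler_wpM2l // mulr_ge0 ?expR_ge0 ?addr_ge0 // ltW.
have -> : (N + 1) * expR 1 * (expR 1 * N * N ^+ n.+1) = expR 1 * (N + 1) * (expR 1 * N ^+ n.+2).
  by rewrite [N ^+ n.+2]exprS; ring.
by rewrite ler_wpM2l // mulr_ge0 ?expR_ge0 ?addr_ge0 // ltW.
Qed.

Lemma sum_pow_half_bounded k : exists C : R, forall n,
  \sum_(m < n) (m.+1%:R ^+ k / 2 ^+ m) <= C.
Proof.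
(* From [x ^ k <= k! e ^ x] at [x = (m + 1) / 4] and [e ^ (1 / 4) <= 4 / 3], the terms are at most
   [D (2 / 3) ^ m]; the geometric series contributes the factor 3. *)
pose D : R := 4 ^+ k * (k`!)%:R * (4 / 3); exists (3 * D) => n.
have D0 : 0 <= D by rewrite !mulr_ge0 // ?exprn_ge0 // divr_ge0.
have e43 : expR (4^-1) <= 4 / 3 :> R.
  have := expR_ge1Dx (- 4^-1 : R); rewrite expRN => h.
  have h2 : 3 / 4 <= (expR 4^-1)^-1 :> R by lra.
  by rewrite -[leLHS]invrK -[leRHS]invrK lef_pV2 ?posrE ?invr_gt0 ?expR_gt0 ?divr_gt0 // invf_div.
have H m : m.+1%:R ^+ k / 2 ^+ m <= D * (2 / 3) ^+ m.
  have h : m.+1%:R ^+ k <= 4 ^+ k * (k`!)%:R * expR (4^-1) ^+ m.+1 :> R.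
    rewrite -expRM_natl; set x : R := m.+1%:R / 4.
    have x0 : 0 <= x by rewrite divr_ge0.
    have -> : m.+1%:R = 4 * x by rewrite /x; field.
    rewrite exprMn -mulrA ler_wpM2l ?exprn_ge0 //.
    case: (k) => [|j]; first by rewrite expr0 mul1r -expR0 ler_expR.
    have h := expR_ge1Dxn j x0; rewrite mulrC -ler_pdivrMr ?ltr0n ?fact_gt0 //; lra.
  rewrite ler_pdivrMr ?exprn_gt0 // (le_trans h) //.
  have -> : D * (2 / 3) ^+ m * 2 ^+ m = 4 ^+ k * (k`!)%:R * (4 / 3) ^+ m.+1.
    rewrite /D -mulrA -exprMn exprS -!mulrA; do 3 congr (_ * _).
    by rewrite mulrA; congr (_ * _); congr (_ ^+ _); field.
  by rewrite ler_wpM2l ?mulr_ge0 ?exprn_ge0 // lerXn2r ?nnegrE ?expR_ge0.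
apply: le_trans (_ : \sum_(m < n) D * (2 / 3) ^+ m <= _); first exact: ler_sum.
rewrite -mulr_sumr mulrC ler_wpM2r //.
have := subrX1 (2 / 3 : R) n; set S := \sum_(i < n) _ => e.
have : 0 <= (2 / 3 : R) ^+ n by rewrite exprn_ge0.
lra.
Qed.

End coefficient_majorants.

Section gaussian_majorants.
Context {R : realType}.
Implicit Types (p q g : {poly R}) (t x : R).

Lemma horner_majorant g t : (majorant g).[t] = \sum_(i < size g) `|g`_i| * t ^+ i.
Proof. by rewrite horner_poly. Qed.

Lemma majorant_ge1 g t : 0 <= t -> g`_0 = 1 -> 1 <= (majorant g).[t].
Proof.
move=> t0 g0; rewrite horner_majorant.
have sg : (0 < size g)%N.
  by rewrite ltnNge; apply/negP => /leq_sizeP/(_ 0 isT)/eqP; rewrite g0 oner_eq0.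
rewrite (bigD1 (Ordinal sg)) //= g0 normr1 expr0 mulr1 lerDl sumr_ge0 // => i _.
by rewrite mulr_ge0 ?exprn_ge0.
Qed.

(** Every surviving monomial has degree [i >= K]; the factor [t ^+ K] is pulled out and the
    remaining [t ^+ (i - K)] is absorbed by the exponential through [le_pow_expR] with
    [c = 1 / 4]. *)
Lemma majorant_sub1_le g K : g`_0 = 1 -> (forall i, (0 < i < K)%N -> g`_i = 0) ->
  exists2 M, 0 <= M &
  forall t, 0 <= t -> (majorant g).[t] - 1 <= M * t ^+ K * expR (t ^+ 2 / 4).
Proof.
move=> g0 gK.
pose c i : R := 1 + (i - K)`!%:R / 4^-1 ^+ (i - K).
have c0 i : 0 <= c i by rewrite addr_ge0 ?divr_ge0 ?exprn_ge0 ?invr_ge0.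
exists (\sum_(i < size g) `|g`_i| * c i).
  by rewrite sumr_ge0 // => i _; rewrite mulr_ge0.
move=> t t0; rewrite horner_majorant lerBlDr.
have sg : (0 < size g)%N.
  by rewrite ltnNge; apply/negP => /leq_sizeP/(_ 0 isT)/eqP; rewrite g0 oner_eq0.
rewrite (bigD1 (Ordinal sg)) //= g0 normr1 expr0 mulr1 addrC lerD2r.
rewrite -mulrA mulr_suml [leRHS](bigD1 (Ordinal sg)) //= -[leLHS]add0r lerD //.
  by rewrite !mulr_ge0 ?expR_ge0 ?exprn_ge0.
apply: ler_sum => i; rewrite -val_eqE /= -lt0n => i0.
have [iK|Ki] := ltnP i K; first by rewrite gK ?i0 // normr0 !mul0r.
rewrite -mulrA ler_wpM2l // -{1}(subnKC Ki) exprD mulrCA ler_wpM2l ?exprn_ge0 //.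
by rewrite (le_trans (@le_pow_expR R _ 4^-1 t _ t0)) // mulrC [4^-1 * _]mulrC mulrC.
Qed.

(* The coefficient is extracted at [t = sqrt (2 m / n)], the saddle point of
   [t ^ (- m) * expR (n * t ^ 2 / 4)]. *)
Lemma weighted_coef_le n m K (M a : R) : (0 < n)%N -> (0 < m)%N -> 0 <= a ->
  (forall t, 0 <= t -> a * t ^+ m <= n%:R * (M * t ^+ K) * expR (t ^+ 2 / 4) ^+ n) ->
  m`!%:R * a ^+ 2 / n%:R ^+ m <=
  n%:R ^+ 2 / n%:R ^+ K * (M ^+ 2 * 2 ^+ K * expR 1 * (m.+1%:R ^+ K.+1 / 2 ^+ m)).
Proof.
move=> n0 m0 a0 H.
have N0 : 0 < n%:R :> R by rewrite ltr0n.
have M0' : 0 < m%:R :> R by rewrite ltr0n.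
set N : R := n%:R in H N0 *; set u : R := 2 * m%:R / N.
have u0 : 0 <= u by rewrite !mulr_ge0 ?invr_ge0 ?ltW.
have := H _ (sqrtr_ge0 u); rewrite sqr_sqrtr // -expRM_natl => {}H.
have sq (b : R) k : (b * Num.sqrt u ^+ k) ^+ 2 = b ^+ 2 * u ^+ k.
  by rewrite exprMn -exprM mulnC exprM sqr_sqrtr.
(* Squaring removes the square roots, and at the chosen point the squared exponential is exactly
   [expR m]. *)
have H2 : a ^+ 2 * u ^+ m <= N ^+ 2 * (M ^+ 2 * u ^+ K) * expR m%:R.
  have -> : expR m%:R = expR (n%:R * (u / 4)) ^+ 2.
    by rewrite -expRM_natl; congr expR; rewrite /u -/N; field; rewrite gt_eqF.
  rewrite -!sq -!exprMn ler_sqr ?nnegrE ?(le_trans _ H) //.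
  - by rewrite mulr_ge0 ?exprn_ge0 ?sqrtr_ge0.
  - by rewrite mulr_ge0 ?exprn_ge0 ?sqrtr_ge0.
have -> : m`!%:R * a ^+ 2 / N ^+ m = m`!%:R / (2 * m%:R) ^+ m * (a ^+ 2 * u ^+ m).
  rewrite /u !exprMn exprVn; field.
  by rewrite ?expf_neq0 ?gt_eqF.
apply: (@le_trans _ _ (m`!%:R / (2 * m%:R) ^+ m * (N ^+ 2 * (M ^+ 2 * u ^+ K) * expR m%:R))).
  by rewrite ler_wpM2l // divr_ge0 // exprn_ge0 // mulr_ge0 // ltW.
(* The factor [m! e ^ m / m ^ m] is isolated for [fact_le_expR]; what remains is [m ^ K / 2 ^ m],
   summable thanks to the 2 in the saddle point. *)
have -> : m`!%:R / (2 * m%:R) ^+ m * (N ^+ 2 * (M ^+ 2 * u ^+ K) * expR m%:R) =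
  N ^+ 2 / N ^+ K * (M ^+ 2 * 2 ^+ K * (m%:R ^+ K / 2 ^+ m * ((m`!%:R * expR m%:R) / m%:R ^+ m))).
  rewrite /u !exprMn exprVn; field.
  by rewrite !expf_neq0 ?gt_eqF.
have N0' := ltW N0.
have A0 : 0 <= M ^+ 2 * 2 ^+ K by rewrite (mulr_ge0 (sqr_ge0 _)) ?exprn_ge0.
rewrite ler_wpM2l ?divr_ge0 ?exprn_ge0 // -[leRHS]mulrA (ler_wpM2l A0) //.
have h : m`!%:R * expR m%:R / m%:R ^+ m <= expR 1 * m.+1%:R :> R.
  by rewrite ler_pdivrMr ?exprn_gt0 // fact_le_expR.
have -> : expR 1 * (m.+1%:R ^+ K.+1 / 2 ^+ m) = m.+1%:R ^+ K / 2 ^+ m * (expR 1 * m.+1%:R) :> R.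
  by rewrite exprS; ring.
apply: ler_pM => //; rewrite ?divr_ge0 ?mulr_ge0 ?expR_ge0 ?exprn_ge0 //.
by rewrite ler_wpM2r ?invr_ge0 ?exprn_ge0 // lerXn2r ?nnegrE // ler_nat.
Qed.

(** The analytic core: [C] is uniform in [n], in the choice [s] of factors and in the truncation
    [N], because [J] is finite and the bounds on individual coefficients are summable in [m]. *)
Lemma weighted_coef_sum_bound K (J : finType) (g : J -> {poly R}) :
  (2 <= K)%N -> (forall j, (g j)`_0 = 1) ->
  (forall j i, (0 < i < K)%N -> (g j)`_i = 0) ->
  (forall j t, 0 <= t -> (majorant (g j)).[t] <= expR (t ^+ 2 / 4)) ->
  exists C, forall n (s : nat -> J) (N : nat), (0 < n)%N ->
    \sum_(m < N | (0 < m)%N) m`!%:R * ((\prod_(i < n) g (s i))`_m) ^+ 2 / n%:R ^+ m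
    <= C / n%:R ^+ (K - 2).
Proof.
move=> K2 g0 gK gexp.
have /choice[M0 HM0] : forall j, exists M, 0 <= M /\
  forall t, 0 <= t -> (majorant (g j)).[t] - 1 <= M * t ^+ K * expR (t ^+ 2 / 4).
  by move=> j; have [M ? ?] := majorant_sub1_le (g0 j) (gK j); exists M.
(* The sum of the nonnegative constants is a common bound for all [j]. *)
pose M := \sum_j M0 j.
have Mge0 : 0 <= M by rewrite sumr_ge0 // => j _; exact: (HM0 j).1.
have HM j t : 0 <= t -> (majorant (g j)).[t] - 1 <= M * t ^+ K * expR (t ^+ 2 / 4).
  move=> t0; rewrite (le_trans ((HM0 j).2 t t0)) // ler_wpM2r ?expR_ge0 //.
  rewrite ler_wpM2r ?exprn_ge0 // /M (bigD1 j) //= lerDl sumr_ge0 // => i _.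
  exact: (HM0 i).1.
have [D HD] := @sum_pow_half_bounded R K.+1.
exists (M ^+ 2 * 2 ^+ K * expR 1 * D) => n s N n0.
set p := \prod_(i < n) g (s i); set q := \prod_(i < n) majorant (g (s i)).
have pq m : `|p`_m| <= q`_m.
  apply: (@le_coef_prod R n (fun i => g (s i)) (fun i => majorant (g (s i)))) => i k.
  by rewrite coef_majorant.
have q0 : q`_0 = 1.
  rewrite -horner_coef0 /q horner_prod big1 // => i _.
  by rewrite horner_coef0 coef_majorant g0 normr1.
have qge m : 0 <= q`_m by exact: le_trans (pq m).
(* With nonnegative coefficients, a single monomial of positive degree is at most [q.[t] - q.[0]],
   which telescoping bounds. *)
have qt t m : 0 <= t -> (0 < m)%N ->
  q`_m * t ^+ m <= n%:R * (M * t ^+ K) * expR (t ^+ 2 / 4) ^+ n.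
  move=> t0 m0.
  apply: le_trans (@prod_sub1_le R n (fun i => (majorant (g (s i))).[t])
    (expR (t ^+ 2 / 4)) (M * t ^+ K) _ _ _).
  - rewrite -horner_prod -/q.
    have [mq|qm] := ltnP m (size q); last first.
      rewrite (nth_default _ qm) mul0r subr_ge0 /q horner_prod.
      elim/big_ind: _ => // [x y x1 y1|i _]; last exact: majorant_ge1.
      by rewrite -[1]mulr1 ler_pM.
    rewrite lerBrDl horner_coef.
    have sq : (0 < size q)%N by rewrite (leq_ltn_trans _ mq).
    rewrite (bigD1 (Ordinal sq)) //= q0 expr0 mulr1 lerD2l.
    rewrite (bigD1 (Ordinal mq)) /=; last by rewrite -val_eqE /= -lt0n.
    by rewrite lerDl sumr_ge0 // => i _; rewrite mulr_ge0 ?exprn_ge0.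
  - by move=> i; rewrite majorant_ge1.
  - by move=> i; exact: gexp.
  - by move=> i; exact: HM.
apply: (@le_trans _ _ (\sum_(m < N) n%:R ^+ 2 / n%:R ^+ K *
    (M ^+ 2 * 2 ^+ K * expR 1 * (m.+1%:R ^+ K.+1 / 2 ^+ m)))).
  rewrite big_mkcond; apply: ler_sum => m _; case: ifPn => m0; last first.
    by rewrite !mulr_ge0 ?expR_ge0 ?invr_ge0 ?exprn_ge0 ?sqr_ge0.
  apply: (@le_trans _ _ (m`!%:R * q`_m ^+ 2 / n%:R ^+ m)); last first.
    by apply: weighted_coef_le => // t t0; exact: qt.
  rewrite ler_wpM2r ?invr_ge0 ?exprn_ge0 // ler_wpM2l //.
  by rewrite -real_normK ?num_real // lerXn2r ?nnegrE.
(* The assumption [2 <= K] makes the truncated exponent [K - 2] a true difference. *)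
have -> : n%:R ^+ 2 / n%:R ^+ K = (n%:R ^+ (K - 2))^-1 :> R.
  have nK : n%:R ^+ K = n%:R ^+ 2 * n%:R ^+ (K - 2) :> R by rewrite -exprD subnKC.
  have nn : n%:R != 0 :> R by rewrite pnatr_eq0 -lt0n.
  by rewrite nK; field; rewrite !expf_neq0.
rewrite -mulr_sumr mulrC ler_wpM2r ?invr_ge0 ?exprn_ge0 // -mulr_sumr ler_wpM2l //.
by rewrite !mulr_ge0 ?expR_ge0 ?exprn_ge0 ?sqr_ge0.
Qed.

End gaussian_majorants.

(** * Hypothesis (H) and Gaussian domination *)

Section gaussian_domination.
Context {R : realType}.
Implicit Types (p q m n k : nat) (t x y c : R).

(** The arithmetic-geometric mean inequality for [p] copies of [x] followed by [q] copies of [y]. *)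
Lemma amgm_pow2 p q x y : 0 <= x -> 0 <= y ->
  x ^+ p * y ^+ q <= ((p%:R * x + q%:R * y) / (p + q)%:R) ^+ (p + q).
Proof.
move=> x0 y0.
pose E (i : 'I_(p + q)) := if (i < p)%N then x else y.
have EL i : E (lshift q i) = x by rewrite /E /= ltn_ord.
have ER i : E (rshift p i) = y by rewrite /E /= ltnNge leq_addr.
have := @leif_AGM R _ predT E _; case=> [i _|]; first by rewrite /E; case: ifP.
rewrite (_ : #|predT| = p + q)%N; last by rewrite cardE size_enum_ord.
rewrite !big_split_ord /=.
under eq_bigr do rewrite EL; under [X in _ * X]eq_bigr do rewrite ER.
under [X in (X + _) / _]eq_bigr do rewrite EL.
under [X in (_ + X) / _]eq_bigr do rewrite ER.
by rewrite !prodr_const !sumr_const !card_ord !mulr_natl.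
Qed.

(** The hypothesis has the shape of each half of (H2a). AM-GM is applied to [1 / (2 p)] taken [p]
    times and [y t ^ (p + q) / q] taken [q] times, whose sum is the right side. *)
Lemma pow_le_half_add p q c y t : (0 < p)%N -> (0 < q)%N -> 0 <= c -> 0 < y -> 0 <= t ->
  (2 * c / (p + q)%:R) ^+ (p + q) * (q%:R / (2 * y)) ^+ q <= 1 / p%:R ^+ p ->
  c * t ^+ q <= 1 / 2 + y * t ^+ (p + q).
Proof.
move=> p0 q0 c0 y0 t0 H.
set n := (p + q)%N in H *.
have n0 : (0 < n)%N by rewrite addn_gt0 p0.
have P0 : 0 < p%:R :> R by rewrite ltr0n.
have Q0 : 0 < q%:R :> R by rewrite ltr0n.
have N0 : 0 < n%:R :> R by rewrite ltr0n.
have tn0 : 0 <= t ^+ n by rewrite exprn_ge0.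
have ytn0 : 0 <= y * t ^+ n by rewrite mulr_ge0 // ltW.
rewrite -(@ler_pXn2r _ n) ?nnegrE ?mulr_ge0 ?exprn_ge0 //; last first.
  by rewrite addr_ge0 // divr_ge0.
have h1 : (2 * c / n%:R) ^+ n <= (2 * y / q%:R) ^+ q / p%:R ^+ p.
  have e : (q%:R / (2 * y)) ^+ q * (2 * y / q%:R) ^+ q = 1.
    rewrite -exprMn (_ : _ / _ * _ = 1) ?expr1n //.
    by field; rewrite !gt_eqF.
  rewrite -[leLHS]mulr1 -[X in _ * X <= _]e mulrA [leRHS]mulrC -[X in _ <= X * _]div1r.
  by rewrite ler_wpM2r // exprn_ge0 // divr_ge0 ?mulr_ge0 // ltW.
have h2 : c ^+ n <= (n%:R / 2) ^+ n * ((2 * y / q%:R) ^+ q / p%:R ^+ p).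
  have -> : c ^+ n = (n%:R / 2) ^+ n * (2 * c / n%:R) ^+ n.
    by rewrite -exprMn; congr (_ ^+ _); field; rewrite gt_eqF.
  by rewrite ler_wpM2l // exprn_ge0 // divr_ge0.
have x0 : 0 <= 1 / (2 * p%:R) :> R by rewrite divr_ge0 // mulr_ge0.
have z0 : 0 <= y * t ^+ n / q%:R by rewrite divr_ge0.
have := amgm_pow2 p q x0 z0.
have -> : p%:R * (1 / (2 * p%:R)) + q%:R * (y * t ^+ n / q%:R) = 1 / 2 + y * t ^+ n.
  by field; rewrite !gt_eqF.
rewrite -/n [leRHS]expr_div_n ler_pdivlMr ?exprn_gt0 // => h3.
apply: le_trans h3.
rewrite exprMn -exprM mulnC exprM.
apply: (@le_trans _ _ ((n%:R / 2) ^+ n * ((2 * y / q%:R) ^+ q / p%:R ^+ p) * (t ^+ n) ^+ q)).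
  by rewrite ler_wpM2r // exprn_ge0.
rewrite le_eqVlt; apply/orP; left; apply/eqP.
have e2 : (2 : R) ^+ n = 2 ^+ p * 2 ^+ q by rewrite -exprD.
rewrite !(exprMn, exprVn) e2 expr1n; field.
by rewrite !expf_neq0 ?gt_eqF.
Qed.

(** The case [K = N = m + 2] of (H2b), where [w] stands for [m ^ (m / 2)]. The claim reduces to
    [(m + 2 - t ^ 2) t ^ m <= 2 w]. *)
Lemma pow_le_one_add m y w t : (0 < m)%N -> 0 <= y -> 0 <= t ->
  0 < w -> w ^+ 2 = m%:R ^+ m -> y <= 1 / (2 * w) ->
  m.+2%:R * y * t ^+ m <= 1 + y * t ^+ m.+2.
Proof.
move=> m0 y0 t0 w0 w2 yw; have M0 : 0 < m%:R :> R by rewrite ltr0n.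
have -> : t ^+ m.+2 = t ^+ m * t ^+ 2 by rewrite -exprD addn2.
suff H : (m.+2%:R - t ^+ 2) * t ^+ m <= 2 * w.
  have h : y * ((m.+2%:R - t ^+ 2) * t ^+ m) <= y * (2 * w) by rewrite ler_wpM2l.
  have h' : y * (2 * w) <= 1 by rewrite -ler_pdivlMr // mulr_gt0.
  have : y * ((m.+2%:R - t ^+ 2) * t ^+ m) = m.+2%:R * y * t ^+ m - y * (t ^+ m * t ^+ 2) by ring.
  lra.
have [neg|/ltW pos] := leP (m.+2%:R - t ^+ 2) 0.
  rewrite (@le_trans _ _ 0) ?mulr_ge0 ?(ltW w0) //.
  by rewrite mulr_le0_ge0 // exprn_ge0.
have w20 : 0 <= 2 * w by rewrite mulr_ge0 // ltW.
rewrite -(@ler_pXn2r _ 2) ?nnegrE ?mulr_ge0 ?exprn_ge0 ?(ltW w0) //.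
(* AM-GM with [t ^ 2 / m] taken [m] times and [(m + 2 - t ^ 2) / 2] taken twice: the mean of these
   numbers is 1. *)
have x0 : 0 <= t ^+ 2 / m%:R by rewrite divr_ge0 ?sqr_ge0.
have z0 : 0 <= (m.+2%:R - t ^+ 2) / 2 by rewrite divr_ge0.
have := amgm_pow2 m 2 x0 z0.
have -> : m%:R * (t ^+ 2 / m%:R) + 2 * ((m.+2%:R - t ^+ 2) / 2) = (m + 2)%:R.
  by rewrite addn2; field; rewrite gt_eqF.
rewrite divff ?pnatr_eq0 ?addn2 // expr1n => h.
have -> : ((m.+2%:R - t ^+ 2) * t ^+ m) ^+ 2 =
  4 * m%:R ^+ m * ((t ^+ 2 / m%:R) ^+ m * ((m.+2%:R - t ^+ 2) / 2) ^+ 2).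
  rewrite [(t ^+ 2 / _) ^+ m]exprMn exprVn -exprM mulnC exprM.
  by field; rewrite expf_neq0 ?gt_eqF.
rewrite [leRHS]exprMn w2 -[leRHS]mulr1 (_ : 2 ^+ 2 = 4 :> R); last by ring.
by rewrite ler_wpM2l // mulr_ge0 // exprn_ge0 ?ltW.
Qed.

(* Gronwall: [G' <= t G] makes [G t * expR (- t ^ 2 / 2)] nonincreasing. *)
Lemma horner_le_expR (G : {poly R}) : G.[0] = 1 ->
  (forall t, 0 <= t -> G^`().[t] <= t * G.[t]) ->
  forall t, 0 <= t -> G.[t] <= expR (t ^+ 2 / 2).
Proof.
move=> G0 dG t t0.
pose e (x : R) := expR (- (x ^+ 2 / 2)).
have de (x : R) : is_derive x 1 e (- x * e x).
  rewrite /e; apply: is_derive_eq.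
  by rewrite /GRing.scale /= ; field.
pose f (x : R) := G.[x] * e x.
have df (x : R) : is_derive x 1 f ((G^`().[x] - x * G.[x]) * e x).
  rewrite /f; have dh := is_derive_poly G x.
  by apply: (is_derive_eq (is_deriveM dh (de x))); rewrite /GRing.scale /=; ring.
have : f t <= f 0.
  apply: (@ler0_derive1_nincry R f 0) => //.
  - move=> x; rewrite in_itv /= andbT => x0.
    rewrite derive1E; have -> := @derive_val _ _ _ _ _ _ _ (df x).
    by rewrite mulr_le0_ge0 ?expR_ge0 // subr_le0 dG // ltW.
  - apply: continuous_subspaceT => x; apply: differentiable_continuous.
    by apply/derivable1_diffP; exact: (@ex_derive _ _ _ _ _ _ _ (df x)).
rewrite /f /e G0 expr0n /= mul0r oppr0 expR0 mulr1 expRN.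
by rewrite ler_pdivrMr ?expR_gt0 // mul1r.
Qed.

End gaussian_domination.

(** * From Hypothesis (H) to the Gaussian bound on majorants *)

Section hypothesis_H_majorant.
Context {R : realType}.
Implicit Types (G g phi : {poly R}) (t : R) (K N : nat).

Lemma horner_gap K e G t : (0 < K)%N -> size G = (K + e).+1 -> G`_0 = 1 ->
  (forall i, (0 < i < K)%N -> G`_i = 0) ->
  G.[t] = 1 + \sum_(i < e.+1) G`_(K + i) * t ^+ (K + i).
Proof.
move=> K0 sG G0 GK; rewrite horner_coef sG -addnS big_split_ord /=; congr (_ + _).
case: K K0 sG GK => // K _ _ GK; rewrite big_ord_recl /= G0 expr0 mulr1 big1 ?addr0 // => i _.
by rewrite GK ?mul0r // /bump leq0n add1n !ltnS ltn_ord.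
Qed.

Lemma horner_deriv_gap K e G t : (0 < K)%N -> size G = (K + e).+1 ->
  (forall i, (0 < i < K)%N -> G`_i = 0) ->
  G^`().[t] = \sum_(i < e.+1) (K + i)%:R * G`_(K + i) * t ^+ (K + i).-1.
Proof.
case: K => // K _ sG GK.
rewrite (@horner_coef_wide _ (K + e.+1)); last first.
  have G0 : G != 0 by rewrite -size_poly_eq0 sG.
  by rewrite -ltnS (leq_trans (lt_size_deriv G0)) // sG addnS addSn.
rewrite big_split_ord /= big1 ?add0r => [|i _]; last first.
  by rewrite coef_deriv GK ?mul0rn ?mul0r //= ltnS ltn_ord.
apply: eq_bigr => i _; rewrite coef_deriv addSn /= mulr_natl; congr (_ * _).
Qed.

(** In [G'], (H1) bounds each term of index at least [K + 2] by the term of [t G] with index two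
    lower. The terms of [t G] left over, namely [t] and the two of highest degree, must pay for
    indices [K] and [K + 1] of [G']: this is (H2a). For [K = N], (H2b) treats the only term. *)
Lemma deriv_le_gap K N G t : (3 <= K)%N -> (K <= N)%N -> size G = N.+1 ->
  (forall i, 0 <= G`_i) -> G`_0 = 1 -> (forall i, (0 < i < K)%N -> G`_i = 0) ->
  (forall k, (K <= k)%N -> (k.+2 <= N)%N -> k.+2%:R * G`_k.+2 <= G`_k) ->
  ((K < N)%N -> G`_N.-1 != 0 /\
    Num.max
    ((2 * K.+1%:R * G`_K.+1 / N%:R) ^+ N * (K.-1%:R / (2 * G`_N)) ^+ K.-1)
    ((2 * K%:R * G`_K / N.-1%:R) ^+ N.-1 * (K.-2%:R / (2 * G`_N.-1)) ^+ K.-2)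
    <= 1 / (N - K).+1%:R ^+ (N - K).+1) ->
  (K = N -> G`_N <= 1 / (2 * (N - 2)%:R `^ ((N - 2)%:R / 2))) ->
  0 <= t -> G^`().[t] <= t * G.[t].
Proof.
move=> K3 KN sG Gge G0 GK H1 H2a H2b t0.
have K0 : (0 < K)%N by apply: leq_trans K3.
have GN : 0 < G`_N.
  rewrite lt_def Gge andbT; apply/negP => /eqP GN0.
  have : lead_coef G != 0 by rewrite lead_coef_eq0 -size_poly_eq0 sG.
  by rewrite lead_coefE sG /= GN0 eqxx.
have := KN; rewrite leq_eqVlt => /predU1P[KNE|KN1].
  have sG' : size G = (K + 0).+1 by rewrite addn0 KNE.
  rewrite (horner_deriv_gap t K0 sG' GK) (horner_gap t K0 sG' G0 GK) !big_ord1 !addn0.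
  have /H2b := KNE; rewrite -KNE => H.
  have [m Km m0] : exists2 m, K = m.+2 & (0 < m)%N by case: (K) K3 => [|[|[|m]]] // _; exists m.+1.
  move: H; rewrite Km subn2 /= => H.
  set w := _ `^ _ in H.
  have w0 : 0 < w by rewrite powR_gt0 // ltr0n.
  have w2 : w ^+ 2 = m%:R ^+ m.
    by rewrite -powR_mulrn ?powR_ge0 // -powRrM -powR_mulrn // divfK.
  have := pow_le_one_add m0 (Gge m.+2) t0 w0 w2 H => h.
  rewrite exprS mulrCA ler_wpM2l //.
have [GN1 Hmax] := H2a KN1.
move: Hmax; rewrite ge_max => /andP[Ha Hb].
have [e Ne] : exists e, N = (K + e.+1)%N.
  by exists (N - K).-1; rewrite prednK ?subn_gt0 // subnKC // ltnW.
move: sG; rewrite Ne => sG.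
rewrite (horner_deriv_gap t K0 sG GK) (horner_gap t K0 sG G0 GK).
(* The two lowest terms of [G'] and the two highest of [G] are split off, leaving [e] terms on each
   side to compare by (H1). *)
rewrite 2!big_ord_recl /= addn0 /bump /= !add1n addn1 /=.
rewrite [in leRHS]big_ord_recr [in leRHS]big_ord_recr /=.
rewrite Ne addnS /= in GN GN1 Ha Hb *.
have GN1' : 0 < G`_(K + e) by rewrite lt_def GN1 Gge.
have hs : \sum_(i < e) (K + bump 0 (bump 0 i))%:R * G`_(K + bump 0 (bump 0 i)) *
     t ^+ (K + bump 0 (bump 0 i)).-1 <= t * \sum_(i < e) G`_(K + i) * t ^+ (K + i).
  rewrite mulr_sumr; apply: ler_sum => i _.
  rewrite /bump /= !add1n !addnS /= [t ^+ (K + i).+1]exprS.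
  rewrite [leRHS]mulrCA ler_wpM2r ?mulr_ge0 ?exprn_ge0 // H1 ?leq_addr //.
  by rewrite Ne addnS !ltnS ltn_add2l.
have [k Kk] : exists k, K = k.+3 by case: (K) K3 => [|[|[|k]]] // _; exists k.
(* First half of (H2a), with exponents [p = N - K + 1] and [q = K - 1]; in the second half below,
   [q = K - 2]. Each uses up one half of the constant term 1. *)
have ha : K.+1%:R * G`_K.+1 * t ^+ k.+2 <= 1 / 2 + G`_(K + e).+1 * t ^+ (K + e).+1.
  have -> : (K + e).+1 = (e.+2 + k.+2)%N by rewrite Kk; lia.
  apply: pow_le_half_add => //; rewrite ?mulr_ge0 //.
    by rewrite (_ : (e.+2 + k.+2)%N = (K + e).+1) // Kk; lia.
  move: Ha; rewrite (_ : ((K + e).+1 - K).+1 = e.+2); last by lia.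
  by rewrite (_ : (K + e).+1 = (e.+2 + k.+2)%N) ?Kk ?mulrA //; lia.
have hb : K%:R * G`_K * t ^+ k.+1 <= 1 / 2 + G`_(K + e) * t ^+ (K + e).
  have E : (K + e)%N = (e.+2 + k.+1)%N by rewrite Kk; lia.
  rewrite E; apply: pow_le_half_add => //; rewrite ?mulr_ge0 //.
    by rewrite -E.
  move: Hb; rewrite (_ : ((K + e).+1 - K).+1 = e.+2); last by lia.
  by rewrite E Kk /= ?mulrA.
have -> : t ^+ K.-1 = t * t ^+ k.+1 by rewrite Kk -exprS.
have -> : t ^+ K = t * t ^+ k.+2 by rewrite Kk -exprS.
have ha' := ler_wpM2l t0 ha; have hb' := ler_wpM2l t0 hb.
move: hs ha' hb'; set S1 := \sum_(i < e) _; set S2 := \sum_(i < e) _.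
move=> hs; rewrite !mulrDr => ha' hb'.
have e1 : K%:R * G`_K * (t * t ^+ k.+1) = t * (K%:R * G`_K * t ^+ k.+1) by ring.
have e2 : K.+1%:R * G`_K.+1 * (t * t ^+ k.+2) = t * (K.+1%:R * G`_K.+1 * t ^+ k.+2) by ring.
rewrite e1 e2; lra.
Qed.

(* [Hgamma k = s ^ k |g_k|] with [s ^ 2 = 1 + N / K >= 2]. *)
Lemma majorant_le_expR K phi g : (3 <= K)%N -> size g = size phi ->
  g`_0 = 1 -> (forall i, (0 < i < K)%N -> g`_i = 0) ->
  (forall k, hermite_coef (horner phi) k = Num.sqrt k`!%:R * g`_k) ->
  hypothesis_H K phi ->
  forall t, 0 <= t -> (majorant g).[t] <= expR (t ^+ 2 / 4).
Proof.
move=> K3 sg g0 gK hc HH t t0.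
have K0 : (0 < K)%N by apply: leq_trans K3.
(* If the degree is below [K], the vanishing coefficients force [g = 1]; this also covers the
   convention [phi = 1]. *)
have [sK|Ks] := leqP (size g) K.
  rewrite horner_majorant; apply: (@le_trans _ _ 1); last first.
    by rewrite -expR0 ler_expR divr_ge0 ?sqr_ge0.
  case: (size g) sK => [|n] nK; first by rewrite big_ord0.
  rewrite big_ord_recl /= g0 normr1 expr0 mulr1 big1 ?addr0 // => i _.
  by rewrite gK ?normr0 ?mul0r // /bump add1n /= (leq_ltn_trans _ nK) // ltn_ord.
case: HH => [phi1|[H1 H2a H2b]].
  by move: Ks; rewrite sg phi1 size_poly1 ltnNge (leq_trans _ K3).
have KN : (K <= (size phi).-1)%N by rewrite -ltnS prednK // -sg ?(leq_trans _ Ks).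
have sN : size phi = (size phi).-1.+1 by rewrite prednK // -sg (leq_trans _ Ks).
set N := (size phi).-1 in KN sN.
pose a : R := 1 + N%:R / K%:R; pose s := Num.sqrt a.
have a2 : 2 <= a.
  by rewrite -[2]/(1 + 1) lerD2l ler_pdivlMr ?ltr0n // mul1r ler_nat.
have a0 : 0 < a by apply: lt_le_trans a2.
have s0 : 0 < s by rewrite sqrtr_gt0.
have s2 : s ^+ 2 = a by rewrite sqr_sqrtr // ltW.
pose G := pdilate s (majorant g).
have GE k : G`_k = Hgamma K phi k.
  rewrite coef_pdilate coef_majorant /Hgamma hc normrM (ger0_norm (sqrtr_ge0 _)).
  have f0 : Num.sqrt k`!%:R != 0 :> R by rewrite gt_eqF // sqrtr_gt0 ltr0n fact_gt0.
  rewrite mulrA [_ * Hcst _ _ k * _]mulrAC mulVf // mul1r; congr (_ * _).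
  rewrite /Hcst -/N -/a mulrC powRrM powR12_sqrt ?(ltW a0) // powR_mulrn ?sqrtr_ge0 //.
have Gsz : size G = N.+1.
  rewrite /G /pdilate size_comp_poly2 -?sN -?sg; last first.
    by rewrite size_scale ?size_polyX // gt_eqF.
  rewrite /majorant size_poly_eq // normr_eq0 -lead_coefE lead_coef_eq0 -size_poly_eq0.
  by rewrite sg sN.
have dG u : 0 <= u -> G^`().[u] <= u * G.[u].
  apply: (@deriv_le_gap K N) => //.
  - by move=> i; rewrite coef_pdilate coef_majorant mulr_ge0 ?exprn_ge0 // ltW.
  - by rewrite coef_pdilate coef_majorant g0 normr1 mulr1.
  - by move=> i iK; rewrite coef_pdilate coef_majorant gK // normr0 mulr0.
  - by move=> k Kk kN; rewrite !GE; exact: H1.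
  - by move=> /H2a; rewrite !GE -/N => -[/(_ K3)].
  - by move=> /H2b; rewrite !GE.
have G0 : G.[0] = 1.
  by rewrite horner_coef0 coef_pdilate coef_majorant g0 normr1 mulr1.
(* Evaluating at [t / s] undoes the dilation, and [s ^+ 2 >= 2] improves the exponent from
   [t ^ 2 / 2] to [t ^ 2 / 4]. *)
have := horner_le_expR G0 dG (divr_ge0 t0 (ltW s0)).
rewrite horner_pdilate mulrC divfK ?gt_eqF // => /le_trans; apply.
rewrite ler_expR exprMn exprVn s2 -mulrA ler_wpM2l ?sqr_ge0 //.
rewrite -invfM lef_pV2 ?posrE ?mulr_gt0 //; lra.
Qed.

End hypothesis_H_majorant.

(** * Integration against the standard normal law *)

Section integral_density.
Local Open Scope ereal_scope.

(** The density [h] agrees almost everywhere with the Radon-Nikodym derivative, for which the change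
    of variables holds. *)
Lemma ge0_integral_density d (T : measurableType d) (R : realType)
    (nu : {finite_measure set T -> \bar R}) (mu : {sigma_finite_measure set T -> \bar R})
    (h : T -> R) (f : T -> \bar R) :
  measurable_fun setT h -> (forall x, (0 <= h x)%R) ->
  (forall A, measurable A -> nu A = \int[mu]_(x in A) (h x)%:E) ->
  measurable_fun setT f -> (forall x, 0 <= f x) ->
  \int[nu]_x f x = \int[mu]_x (f x * (h x)%:E).
Proof.
move=> mh h0 nuE mf f0.
have mhE : measurable_fun setT (EFin \o h) by apply/measurable_EFinP.
have numu : nu `<< mu.
  apply/null_content_dominatesP => A mA muA; rewrite nuE //.
  by apply: null_set_integral => //; exact: measurable_funTS.
have ih : mu.-integrable setT (EFin \o h).
  apply/integrableP; split => //.
  under eq_integral do rewrite /= ger0_norm ?h0 //.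
  by rewrite -nuE // -ge0_fin_numE // fin_num_measure.
rewrite -(Radon_Nikodym_SigmaFinite.change_of_variables numu) //.
apply: ae_eq_integral => //.
- apply: emeasurable_funM => //.
  exact: measurable_int (Radon_Nikodym_SigmaFinite.f_integrable numu).
- exact: emeasurable_funM.
apply: ae_eqe_mul2l; apply: integral_ae_eq => //.
  exact: Radon_Nikodym_SigmaFinite.f_integrable numu.
move=> A _ mA; rewrite -nuE //; apply/esym.
exact: Radon_Nikodym_SigmaFinite.f_integral numu _ mA.
Qed.

End integral_density.

(** * Gaussian moments *)

Section normal_moments.
Context {R : realType}.
Local Notation mu := (std_normal R).
Local Notation leb := (@lebesgue_measure R).
Local Notation w := (@normal_pdf R 0 1).
Implicit Types (n m : nat) (x : R).

Lemma ge0_integral_std_normal (f : R -> \bar R) :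
  measurable_fun setT f -> (forall x, 0 <= f x)%E ->
  (\int[mu]_x f x = \int[leb]_x (f x * (w x)%:E))%E.
Proof.
move=> mf f0; apply: (@ge0_integral_density _ _ _ mu leb) => //.
- exact: measurable_normal_pdf.
- by move=> x; exact: normal_pdf_ge0.
Qed.

Lemma std_normal_pdfE x : w x = normal_peak 1 * expR (- (x ^+ 2 / 2)).
Proof. by rewrite normal_pdfE ?oner_eq0 // /normal_fun subr0 expr1n mulNr. Qed.

Lemma is_derive_std_normal_pdf x : is_derive x 1 (w : R -> R) (- x * w x).
Proof.
have -> : w = fun x => normal_peak 1 * expR (- (x ^+ 2 / 2)).
  by apply/funext => y; exact: std_normal_pdfE.
by apply: is_derive_eq; rewrite /GRing.scale /=; field.
Qed.

(** The boundary terms of the integration by parts below vanish: one term of the exponential series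
    bounds them by a multiple of [1 / (m + 1)]. *)
Lemma cvg_pow_std_normal_pdf k :
  (fun m => m.+1%:R ^+ k.*2.+1 * w m.+1%:R) @ \oo --> (0 : R).
Proof.
pose c : R := normal_peak 1 * (k.+1`!%:R * 2 ^+ k.+1).
have c0 : 0 <= c by rewrite mulr_ge0 ?normal_peak_ge0 // mulr_ge0 ?exprn_ge0.
apply: (@squeeze_cvgr _ _ _ _ (fun=> 0) (fun m => c * m.+1%:R^-1)).
- apply: nearW => m; rewrite mulr_ge0 ?exprn_ge0 ?normal_pdf_ge0 //=.
  set M : R := m.+1%:R; have M0 : 0 < M by rewrite ltr0n.
  rewrite std_normal_pdfE.
  suff H : M ^+ k.*2.+1 * expR (- (M ^+ 2 / 2)) <= k.+1`!%:R * 2 ^+ k.+1 / M.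
    have := ler_wpM2l (normal_peak_ge0 1) H; rewrite /c; congr (_ <= _); ring.
  have u0 : 0 <= M ^+ 2 / 2 by rewrite divr_ge0 ?sqr_ge0.
  have := expR_ge1Dxn k u0; rewrite expr_div_n -exprM => h.
  rewrite expRN ler_pdivrMr ?expR_gt0 // mulrAC ler_pdivlMr // -exprSr -doubleS -mul2n.
  have h' : M ^+ (2 * k.+1) / 2 ^+ k.+1 / k.+1`!%:R <= expR (M ^+ 2 / 2) by lra.
  rewrite !ler_pdivrMr ?exprn_gt0 ?ltr0n ?fact_gt0 // in h'.
  by rewrite (le_trans h') // le_eqVlt; apply/orP; left; apply/eqP; ring.
- exact: cvg_cst.
- rewrite -[X in _ --> X](mulr0 c); apply: cvgM; first exact: cvg_cst.
  exact: cvg_harmonic.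
Qed.

Let mpow n : measurable_fun setT (fun x : R => x ^+ n).
Proof. by apply: continuous_measurable_fun => x; exact: exprn_continuous. Qed.

Let mw : measurable_fun setT (w : R -> R).
Proof. exact: measurable_normal_pdf. Qed.

(** Integration by parts on growing symmetric intervals, using that [- w] has derivative [x * w x].
    Even powers keep the integrands nonnegative, so monotone convergence gives the limit. *)
Lemma even_moment_lebesgue k :
  (\int[leb]_x (x ^+ k.*2 * w x)%:E = (gmoment k.*2 : R)%:E)%E.
Proof.
elim: k => [|k IH].
  by under eq_integral do rewrite mul1r; rewrite integral_normal_pdf.
pose S m : set R := `[- m.+1%:R, m.+1%:R]%classic.
have cvgS (f : R -> R) : (forall x, 0 <= f x) -> measurable_fun setT f ->
    (\int[leb]_(x in S m) (f x)%:E)%E @[m --> \oo] --> (\int[leb]_x (f x)%:E)%E.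
  move=> f0 mf.
  have ST : \bigcup_m S m = setT.
    rewrite -subTset => x _.
    exists (Num.truncn `|x|) => //; rewrite /S /= in_itv /= -ler_norml.
    by rewrite ltW // truncnS_gt.
  rewrite -[X in integral _ X]ST; apply: ge0_nondecreasing_set_cvg_integral => //.
  - move=> a b ab; apply/subsetPset; apply: subset_itv; rewrite bnd_simp ?lerN2 ler_nat ltnS //.
  - by move=> i; exact: measurable_itv.
  - by move=> i; apply/measurable_funTS/measurable_EFinP.
  - by move=> i x _; rewrite lee_fin.
have pos j x : 0 <= x ^+ j.*2 * w x.
  by rewrite mulr_ge0 ?normal_pdf_ge0 // -mul2n exprM exprn_ge0 // sqr_ge0.
have mm j : measurable_fun setT (fun x => x ^+ j.*2 * w x) by exact: measurable_funM.
have ibp m : (\int[leb]_(x in S m) (x ^+ k.+1.*2 * w x)%:E =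
  (- (2 * (m.+1%:R ^+ k.*2.+1 * w m.+1%:R)))%:E +
  k.*2.+1%:R%:E * \int[leb]_(x in S m) (x ^+ k.*2 * w x)%:E)%E.
  pose M : R := m.+1%:R; have M0 : 0 < M by rewrite ltr0n.
  have ab : - M < M by lra.
  have dpow x : is_derive x 1 (fun x : R => x ^+ k.*2.+1) (k.*2.+1%:R * x ^+ k.*2).
    have -> : (fun x : R => x ^+ k.*2.+1) = horner 'X^(k.*2.+1).
      by apply/funext => y; rewrite hornerXn.
    have D := is_derive_poly 'X^(k.*2.+1) x.
    by apply: (is_derive_eq D); rewrite derivXn hornerMn hornerXn mulr_natl.
  have dG x : is_derive x 1 (fun x : R => - w x) (x * w x).
    have := is_derive_std_normal_pdf x => D.
    by apply: is_derive_eq; rewrite mulNr opprK.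
  have cw : continuous (w : R -> R) by apply: continuous_normal_pdf; rewrite oner_eq0.
  have diffc (h dh : R -> R) : (forall x, is_derive x 1 h (dh x)) ->
      derivable_oo_LRcontinuous h (- M) M.
    move=> Dh; have ch : continuous h.
      by move=> x; apply/differentiable_continuous/derivable1_diffP; exact: ex_derive.
    split.
    - by move=> x _; exact: ex_derive.
    - exact: cvg_at_right_filter (ch _).
    - exact: cvg_at_left_filter (ch _).
  have := @integration_by_parts R (fun x => x ^+ k.*2.+1) (fun x => - w x)
    (fun x => k.*2.+1%:R * x ^+ k.*2) (fun x => x * w x) _ _ ab.
  have -> : (\int[leb]_(x in `[(- M)%R, M%R]) (x ^+ k.*2.+1 * (x * w x))%:E =
      \int[leb]_(x in S m) (x ^+ k.+1.*2 * w x)%:E)%E.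
    by apply: eq_integral => x _; rewrite mulrA -exprSr.
  move=> ->.
  - congr (_ + _)%E.
      have -> : w (- M) = w M by rewrite !std_normal_pdfE sqrrN.
      have -> : (- M) ^+ k.*2.+1 = - M ^+ k.*2.+1 by rewrite exprNn -signr_odd /= odd_double expr1 mulN1r.
      by congr (_%:E); rewrite -/M; ring.
    rewrite -ge0_integralZl //=.
    - rewrite [X in (- X)%E](_ : _ = (\int[leb]_(x in S m) - (k.*2.+1%:R%:E * (x ^+ k.*2 * w x)%:E))%E).
        rewrite integral_ge0N ?oppeK // => x _.
        by rewrite mule_ge0 // lee_fin.
      by apply: eq_integral => x _; rewrite -EFinM -EFinN; congr (_%:E); ring.
    - exact: measurable_itv.
    - by apply/measurable_EFinP; apply: measurable_funTS; exact: mm.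
    - by move=> x _; rewrite lee_fin.
  - apply: continuous_subspaceT => x; apply: cvgM; first exact: cvg_cst.
    exact: exprn_continuous.
  - exact: diffc dpow.
  - by move=> x _; rewrite derive1E; exact: derive_val.
  - apply: continuous_subspaceT => x; apply: cvgM; first exact: cvg_id.
    exact: cw.
  - exact: diffc dG.
  - by move=> x _; rewrite derive1E; exact: derive_val.
rewrite -(cvg_lim (@ereal_hausdorff R) (cvgS _ (pos k.+1) (mm k.+1))).
apply: cvg_lim => //; rewrite (funext ibp) -[X in _ --> X]add0e; apply: cvgeD => //.
  apply: cvg_EFin; first exact: nearW.
  have {2}-> : 0%R = (- (2 * 0))%R :> R by rewrite mulr0 oppr0.
  by apply: cvgN; apply: cvgM; [exact: cvg_cst|exact: cvg_pow_std_normal_pdf].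
have -> : (gmoment k.+1.*2)%:E = (k.*2.+1%:R%:E * (gmoment k.*2)%:E)%E :> \bar R.
  by rewrite doubleS /= EFinM.
apply: cvgeZl => //.
by rewrite -IH; exact: cvgS.
Qed.

End normal_moments.

Section std_normal_polynomials.
Context {R : realType}.
Local Notation mu := (std_normal R).
Local Notation leb := (@lebesgue_measure R).
Local Notation w := (@normal_pdf R 0 1).
Implicit Types (n m : nat) (x : R) (p q : {poly R}).

Lemma ge0_integral_lebesgueN (f : R -> \bar R) :
  measurable_fun setT f -> (forall x, 0 <= f x)%E ->
  (\int[leb]_x f (- x)%R = \int[leb]_x f x)%E.
Proof.
move=> mf f0.
transitivity (\int[pushforward leb (-%R : _ -> measurableTypeR R)]_x f x)%E.
  by rewrite ge0_integral_pushforward.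
by apply: eq_measure_integral => A mA _; exact: lebesgue_measureN.
Qed.

(** The image measure scaled by [a] agrees with Lebesgue measure on half-open intervals, hence
    everywhere by uniqueness. *)
Lemma lebesgue_measure_affine (a b : R) (A : set R) : 0 < a -> measurable A ->
  (leb ((fun x => a * x + b)%R @^-1` A) = a^-1%:E * leb A)%E.
Proof.
move=> a0 mA; pose F x := a * x + b.
have mF : measurable_fun setT (F : R -> measurableTypeR R).
  by apply: measurable_funD => //; exact: measurable_funM.
pose pf : {measure set (measurableTypeR R) -> \bar R} :=
  measure_function_pushforward__canonical__measure_function_Measure leb mF.
have H : (leb A = mscale (NngNum (ltW a0)) pf A)%E.
  apply: (@lebesgue_measure_unique R (mscale (NngNum (ltW a0)) pf)) => //= _ [[c d]] _ <-.
  rewrite /mscale /= /pushforward.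
  have -> : F @^-1` `]c, d]%classic = `](c - b) / a, (d - b) / a]%classic.
    apply/seteqP; split => x /=; rewrite !in_itv /= ltr_pdivrMr // ler_pdivlMr // /F;
    by rewrite ltrBlDr lerBrDr [x * a]mulrC.
  rewrite !lebesgue_measure_itv /= !lte_fin ltr_pM2r ?invr_gt0 // ltrD2r.
  case: ifPn => _; last by rewrite mule0.
  by rewrite -!EFinB -EFinM; congr (_%:E); field; rewrite gt_eqF.
by rewrite H /mscale /= /pushforward muleA -EFinM mulVf ?gt_eqF // mul1e.
Qed.

Lemma ge0_integral_affine (a b : R) (f : R -> \bar R) : 0 < a ->
  measurable_fun setT f -> (forall x, 0 <= f x)%E ->
  (\int[leb]_x f (a * x + b)%R = a^-1%:E * \int[leb]_x f x)%E.
Proof.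
move=> a0 mf f0.
have a'0 : 0 <= a^-1 by rewrite invr_ge0 ltW.
have mF : measurable_fun setT ((fun x => a * x + b) : R -> measurableTypeR R).
  by apply: measurable_funD => //; exact: measurable_funM.
transitivity (\int[pushforward leb ((fun x => a * x + b)%R : R -> measurableTypeR R)]_x f x)%E.
  by rewrite ge0_integral_pushforward.
rewrite -(ge0_integral_mscale leb measurableT (NngNum a'0) mf) //.
by apply: eq_measure_integral => A mA _; exact: lebesgue_measure_affine.
Qed.

Lemma measurable_horner p : measurable_fun setT (horner p).
Proof. by apply: continuous_measurable_fun => x; exact: continuous_horner. Qed.

Lemma even_moment k : (\int[mu]_x (x ^+ k.*2)%:E = (gmoment k.*2 : R)%:E)%E.
Proof.
rewrite ge0_integral_std_normal.
- by rewrite -even_moment_lebesgue; apply: eq_integral => x _; rewrite EFinM.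
- by apply/measurable_EFinP; exact: exprn_measurable.
- by move=> x; rewrite lee_fin -mul2n exprM exprn_ge0 // sqr_ge0.
Qed.

Lemma integrable_even_pow k : mu.-integrable setT (fun x => (x ^+ k.*2)%:E).
Proof.
apply/integrableP; split; first by apply/measurable_EFinP; exact: exprn_measurable.
under eq_integral => x _.
  rewrite abse_EFin ger0_norm; last by rewrite -mul2n exprM exprn_ge0 // sqr_ge0.
  over.
by rewrite even_moment ltry.
Qed.

(** Domination by an even power: [|x| ^ n <= 1 + x ^ (2 n)]. *)
Lemma integrable_pow n : mu.-integrable setT (fun x => (x ^+ n)%:E).
Proof.
apply: (@le_integrable _ _ _ mu setT measurableT _ (fun x => (1 + x ^+ n.*2)%:E)).
- by apply/measurable_EFinP; exact: exprn_measurable.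
- move=> x _; rewrite lee_fin -mul2n mulnC exprM normrX.
  rewrite [leRHS]ger0_norm ?addr_ge0 ?sqr_ge0 //.
  have := sqr_ge0 (`|x| ^+ n - 1); rewrite -[(x ^+ n) ^+ 2]real_normK ?num_real // normrX.
  have := exprn_ge0 n (normr_ge0 x); set y := `|x| ^+ n => y0 h; nra.
rewrite (_ : (fun _ => _) = ((fun=> 1%:E) \+ (fun x : R => (x ^+ n.*2)%:E))%E).
  apply: integrableD => //; last exact: integrable_even_pow.
  by have := integrable_even_pow 0.
by apply/funext => x; rewrite EFinD.
Qed.

Lemma gmoment_odd k : gmoment k.*2.+1 = 0 :> R.
Proof. by elim: k => //= k ->; rewrite mulr0. Qed.

Lemma moment n : (\int[mu]_x (x ^+ n)%:E = (gmoment n : R)%:E)%E.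
Proof.
rewrite -[n]odd_double_half; case: (odd n); last by rewrite add0n even_moment.
rewrite add1n gmoment_odd; set m := n./2.*2.+1.
have mN x : (- x) ^+ m = - x ^+ m by rewrite exprNn -signr_odd /= odd_double expr1 mulN1r.
(* A nonnegative function with odd part [2 x ^ m], so that the reflection rule for nonnegative
   integrands applies; equality of the integrals of [f (- x)] and [f x] makes the odd moment
   vanish. *)
pose f x : R := (1 + x ^+ m) ^+ 2.
have mf : measurable_fun setT f.
  by apply: measurable_funX; apply: measurable_funD => //; exact: exprn_measurable.
have f0 x : 0 <= f x by exact: sqr_ge0.
have wN x : w (- x) = w x by rewrite !std_normal_pdfE sqrrN.
have sym : (\int[mu]_x (f (- x))%:E = \int[mu]_x (f x)%:E)%E.
  have mw : measurable_fun setT (fun x => ((f x)%:E * (w x)%:E)%E).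
    by apply: emeasurable_funM; apply/measurable_EFinP => //; exact: measurable_normal_pdf.
  have fw0 x : (0 <= (f x)%:E * (w x)%:E)%E by rewrite mule_ge0 // lee_fin ?normal_pdf_ge0.
  rewrite !ge0_integral_std_normal //.
  - rewrite -[RHS](ge0_integral_lebesgueN mw) //.
    by apply: eq_integral => x _; rewrite wN.
  - exact/measurable_EFinP.
  - by apply/measurable_EFinP; apply: (measurableT_comp mf).
  - by move=> x; rewrite lee_fin.
have i0 : mu.-integrable setT (fun x => (1 + x ^+ m.*2)%:E).
  rewrite (_ : (fun _ => _) = ((fun=> 1%:E) \+ (fun x : R => (x ^+ m.*2)%:E))%E).
    apply: integrableD => //; last exact: integrable_pow.
    by have := integrable_pow 0.
  by apply/funext => x; rewrite EFinD.
have split (s : R) : (\int[mu]_x (1 + x ^+ m.*2 + s * x ^+ m)%:E =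
    \int[mu]_x (1 + x ^+ m.*2)%:E + s%:E * \int[mu]_x (x ^+ m)%:E)%E.
  under eq_integral do rewrite EFinD EFinM.
  rewrite integralD //; last by apply: integrableZl => //; exact: integrable_pow.
  by rewrite integralZl //; exact: integrable_pow.
have : (\int[mu]_x (x ^+ m)%:E)%E \is a fin_num by apply: integrable_fin_num => //; exact: integrable_pow.
have : (\int[mu]_x (1 + x ^+ m.*2)%:E)%E \is a fin_num by exact: integrable_fin_num.
move: sym.
have -> : (\int[mu]_x (f (- x))%:E = \int[mu]_x (1 + x ^+ m.*2 + (- 2) * x ^+ m)%:E)%E.
  by apply: eq_integral => x _; congr (_%:E); rewrite /f mN -muln2 exprM; ring.
have -> : (\int[mu]_x (f x)%:E = \int[mu]_x (1 + x ^+ m.*2 + 2 * x ^+ m)%:E)%E.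
  by apply: eq_integral => x _; congr (_%:E); rewrite /f -muln2 exprM; ring.
rewrite !split; case: (\int[mu]_x (x ^+ m)%:E)%E => // a; case: (integral _ _ _) => // b.
by rewrite -!EFinM -!EFinD => -[] ab _ _; congr (_%:E); lra.
Qed.

Lemma integrable_horner p : mu.-integrable setT (EFin \o horner p).
Proof.
elim/poly_ind: p => [|p c _]; last first.
  move: (p * 'X + c%:P) => q.
  rewrite (_ : EFin \o _ = fun x => (\sum_(i < size q) (q`_i)%:E * (x ^+ i)%:E)%E).
    apply: integrable_sum => // i _; apply: integrableZl => //.
    exact: integrable_pow.
  by apply/funext => x /=; rewrite horner_coef sumEFin.
rewrite (_ : EFin \o _ = cst 0%E) ?integrable0 //.
by apply/funext => x /=; rewrite horner0.
Qed.

Lemma integral_horner p : (\int[mu]_x (p.[x])%:E = (gmean p)%:E)%E.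
Proof.
transitivity (\int[mu]_x (\sum_(i < size p) (p`_i)%:E * (x ^+ i)%:E))%E.
  by apply: eq_integral => x _; rewrite horner_coef sumEFin.
rewrite integral_sum //; last first.
  by move=> i; apply: integrableZl => //; exact: integrable_pow.
rewrite -sumEFin; apply: eq_bigr => i _; rewrite integralZl ?moment //.
exact: integrable_pow.
Qed.

(** Rodrigues' formula: every derivative of the Gaussian applies the creation operator up to sign,
    and the two signs [(-1) ^+ n] cancel. *)
Lemma hermite_herm n x : hermite n x = (herm n).[x] / Num.sqrt n`!%:R.
Proof.
pose e (y : R) := expR (- (y ^+ 2 / 2)).
have dn k : derive1n k e = fun y => (-1) ^+ k * (herm k).[y] * e y.
  elim: k => [|k IH].
    by apply/funext => y; rewrite /= hornerC mul1r mul1r.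
  rewrite derive1nS IH; apply/funext => y; rewrite derive1E.
  have de : is_derive y 1 e (- y * e y).
    by rewrite /e; apply: is_derive_eq; rewrite /GRing.scale /=; field.
  have dh := is_derive_poly (herm k) y.
  have d1 := is_deriveM dh de.
  have d2 : is_derive y 1 (fun y => (-1) ^+ k * (herm k).[y] * e y)
    ((-1) ^+ k.+1 * (herm k.+1).[y] * e y).
    rewrite (_ : (fun _ => _) = (-1) ^+ k \*: (horner (herm k) * e)); last first.
      by apply/funext => z; rewrite -mulrA.
    apply: is_derive_eq.
    rewrite -[LHS]/((-1) ^+ k * ((herm k).[y] * (- y * e y) + e y * (herm k)^`().[y])).
    rewrite exprS [herm k.+1]/= hornerD hornerN hornerM hornerX; ring.
  exact: derive_val.
rewrite /hermite dn /e expRN.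
have e0 : expR (x ^+ 2 / 2) != 0 by rewrite gt_eqF ?expR_gt0.
have s1 : (-1) ^+ n * (-1) ^+ n = 1 :> R by rewrite -exprMn mulrNN mulr1 expr1n.
transitivity (((-1) ^+ n * (-1) ^+ n) * (herm n).[x] / Num.sqrt n`!%:R *
   (expR (x ^+ 2 / 2) / expR (x ^+ 2 / 2))); first by ring.
by rewrite s1 divff // mul1r mulr1.
Qed.

Lemma hermite_coef_hexp q k : hermite_coef (horner (hexp q)) k = Num.sqrt k`!%:R * q`_k.
Proof.
have f0 : 0 < Num.sqrt k`!%:R :> R by rewrite sqrtr_gt0 ltr0n fact_gt0.
rewrite /hermite_coef /Rintegral.
have -> : (\int[mu]_x ((hexp q).[x] * hermite k x)%:E =
    \int[mu]_x (((Num.sqrt k`!%:R)^-1 *: (herm k * hexp q)).[x])%:E)%E.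
  by apply: eq_integral => x _; rewrite hermite_herm hornerZ hornerM mulrA mulrC; congr (_%:E); rewrite [X in _ * X]mulrC.
rewrite integral_horner /= gmeanZ gmean_hermh.
by rewrite -{2}(@sqr_sqrtr _ k`!%:R) // expr2 mulrA mulrA mulVf ?mul1r // gt_eqF.
Qed.

End std_normal_polynomials.

(** * Orthogonal invariance of the Gaussian plane *)

Section gaussian_rotation.
Context {R : realType}.
Local Notation mu := (std_normal R).
Local Notation leb := (@lebesgue_measure R).
Local Notation w := (@normal_pdf R 0 1).
Local Open Scope ereal_scope.

Lemma ge0_integral_std_normal2 (F : R * R -> \bar R) :
  measurable_fun setT F -> (forall z, 0 <= F z) ->
  \int[mu]_y \int[mu]_x F (y, x) =
  \int[leb]_y \int[leb]_x (F (y, x) * (w x * w y)%:E).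
Proof.
move=> mF F0.
have mw : measurable_fun setT (w : R -> R) by exact: measurable_normal_pdf.
have w0 x : (0 <= w x)%R by exact: normal_pdf_ge0.
rewrite ge0_integral_std_normal; last 2 first.
  exact: measurable_fun_fubini_tonelli_F.
  by move=> y; exact: integral_ge0.
apply: eq_integral => y _; rewrite ge0_integral_std_normal //; last first.
  by apply: measurableT_comp => //; exact: measurable_pair1.
rewrite -ge0_integralZr //.
- by apply: eq_integral => x _; rewrite -muleA EFinM.
- apply: emeasurable_funM; last exact/measurable_EFinP.
  by apply: measurableT_comp => //; exact: measurable_pair1.
- by move=> x _; rewrite mule_ge0 ?lee_fin.
- by rewrite lee_fin.
Qed.

(** Two affine substitutions in one variable with a Tonelli exchange between them: first
    [z = a y + b x] at fixed [y], then [y = a z + b v] at fixed [z]. Their Jacobians cancel, and the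
    Gaussian weight depends only on the norm. *)
Lemma std_normal_rotation (a b : R) (F : R * R -> \bar R) :
  (a ^+ 2 + b ^+ 2 = 1)%R -> (0 < b)%R ->
  measurable_fun setT F -> (forall z, 0 <= F z) ->
  \int[mu]_y \int[mu]_x F (y, x) =
  \int[mu]_z \int[mu]_v F (a * z + b * v, b * z - a * v)%R.
Proof.
move=> ab b0 mF F0.
have mw : measurable_fun setT (w : R -> R) by exact: measurable_normal_pdf.
have w0 x : (0 <= w x)%R by exact: normal_pdf_ge0.
have mlin (c d : R) : measurable_fun setT (fun z : R * R => (c * z.1 + d * z.2)%R).
  by apply: measurable_funD; apply: measurable_funM.
pose G (z : R * R) := F z * (w z.2 * w z.1)%:E.
have G0 z : 0 <= G z by rewrite mule_ge0 // lee_fin mulr_ge0.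
have mG : measurable_fun setT G.
  apply: emeasurable_funM => //; apply/measurable_EFinP; apply: measurable_funM.
    exact: (measurableT_comp mw).
  exact: (measurableT_comp mw).
(* [H] is the integrand in the intermediate coordinates [(y, z)], where [x = (z - a y) / b]. *)
pose H (z : R * R) := (b^-1)%:E * G (z.1, b^-1 * z.2 + - (a / b) * z.1)%R.
have H0 z : 0 <= H z by rewrite mule_ge0 // lee_fin invr_ge0 ltW.
have mH : measurable_fun setT H.
  apply: emeasurable_funM => //; apply: (measurableT_comp mG).
  apply: measurable_fun_pair => //.
  rewrite (_ : (fun _ => _) = (fun z : R * R => - (a / b) * z.1 + b^-1 * z.2)%R) //.
  by apply/funext => z; rewrite addrC.
have mG1 y : measurable_fun setT (fun x => G (y, x)).
  by apply: (measurableT_comp mG); exact: measurable_pair1.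
have mH2 z : measurable_fun setT (fun y => H (y, z)).
  by apply: (measurableT_comp mH); exact: measurable_pair2.
pose F' (z : R * R) := F (a * z.1 + b * z.2, b * z.1 - a * z.2)%R.
have mF' : measurable_fun setT F'.
  apply: (measurableT_comp mF); apply: measurable_fun_pair => //.
  rewrite (_ : (fun _ => _) = (fun z : R * R => b * z.1 + (- a) * z.2)%R) //.
  by apply/funext => z; rewrite mulNr.
have F'0 z : 0 <= F' z by exact: F0.
rewrite ge0_integral_std_normal2 // (@ge0_integral_std_normal2 F') //.
transitivity (\int[leb]_y \int[leb]_z H (y, z)).
  apply: eq_integral => y _.
  have bi : (0 < b^-1)%R by rewrite invr_gt0.
  have := ge0_integral_affine (- (a / b) * y)%R bi (mG1 y) (fun x => G0 (y, x)).
  rewrite invrK => /(congr1 (fun u => (b^-1)%:E * u)).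
  rewrite muleA -EFinM mulVf ?gt_eqF // mul1e => <-.
  rewrite -ge0_integralZl //.
  - apply: (measurableT_comp (mG1 y)).
    by apply: measurable_funD => //; exact: measurable_funM.
  - by rewrite lee_fin invr_ge0 ltW.
transitivity (\int[leb]_z \int[leb]_y H (y, z)).
  exact: (@fubini_tonelli _ _ _ _ _ leb leb H mH H0).
apply: eq_integral => z _.
have cancelb (u v : \bar R) : u = (b^-1)%:E * v -> v = b%:E * u.
  by move=> ->; rewrite muleA -EFinM (mulfV (lt0r_neq0 b0)) mul1e.
rewrite (cancelb _ _ (ge0_integral_affine (a * z)%R b0 (mH2 z) (fun y => H0 (y, z)))).
rewrite -ge0_integralZl //; last 2 first.
- apply: (measurableT_comp (mH2 z)).
  by apply: measurable_funD => //; exact: measurable_funM.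
- by rewrite lee_fin ltW.
apply: eq_integral => v _; rewrite /H /G /=.
rewrite -(cancelb _ _ erefl).
have -> : (b^-1 * z + - (a / b) * (b * v + a * z) = b * z - a * v)%R.
  have e : (b * z = b^-1 * z - a ^+ 2 / b * z)%R.
    rewrite -mulrBl; congr (_ * _)%R; apply: (mulfI (lt0r_neq0 b0)).
    rewrite mulrBr divff ?gt_eqF // mulrCA divff ?gt_eqF // mulr1 -ab; ring.
  by rewrite e; field; rewrite gt_eqF.
rewrite [(b * v + a * z)%R]addrC; congr (_ * _%:E).
have ww c d : (w c * w d = normal_peak 1 ^+ 2 * expR (- ((c ^+ 2 + d ^+ 2) / 2)))%R.
  rewrite !std_normal_pdfE mulrACA -expRD expr2; congr (_ * expR _)%R; ring.
rewrite !ww; congr (_ * expR (- (_ / 2)))%R.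
transitivity ((a ^+ 2 + b ^+ 2) * (z ^+ 2 + v ^+ 2))%R; first by ring.
by rewrite ab mul1r addrC.
Qed.

End gaussian_rotation.

(** * Densities of sums of independent variables *)

Section independence.
Local Open Scope ereal_scope.
Context d (T : measurableType d) (R : realType) (P : probability T R).

(** Uniqueness of the product measure, applied to the law of the pair under [P] conditioned on [C].
    The event [C] carries the later variables through the induction of [partial_sum_indep]. *)
Lemma joint_law (Y X : {RV P >-> R}) (C : set T) : measurable C ->
  (forall U V, measurable U -> measurable V ->
    P (Y @^-1` U `&` X @^-1` V `&` C) = P (Y @^-1` U) * P (X @^-1` V) * P C) ->
  forall D, measurable D ->
    P ((fun t => (Y t, X t)) @^-1` D `&` C) =
    (distribution P Y \x distribution P X) D * P C.
Proof.
move=> mC H D mD.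
have mYX : measurable_fun setT (fun t => (Y t, X t)) by exact: measurable_fun_pair.
have mpre E : measurable E -> measurable ((fun t => (Y t, X t)) @^-1` E).
  by move=> mE; rewrite -[X in measurable X]setTI; exact: mYX.
have fC : P C \is a fin_num by exact: fin_num_measure.
(* Conditioning on a null event is impossible, but then both sides are 0. *)
have [PC0|PC0] := eqVneq (P C) 0.
  rewrite PC0 mule0; apply/eqP; rewrite -measure_le0 -PC0.
  by apply: le_measure; rewrite ?inE //; apply: measurableI => //; exact: mpre.
have c0 : (0 < fine (P C))%R by rewrite fine_gt0 // lt0e PC0 measure_ge0 ltey_eq fC.
have ci0 : (0 <= (fine (P C))^-1)%R by rewrite invr_ge0 ltW.
pose pf : {measure set (R * R) -> \bar R} :=
  measure_function_pushforward__canonical__measure_function_Measure (mrestr P mC) mYX.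
have cancelC (u : \bar R) : (fine (P C))^-1%:E * (u * P C) = u.
  by rewrite muleC -muleA -{1}(fineK fC) -EFinM divff ?mule1 // gt_eqF.
have prodE : (distribution P Y \x distribution P X) D = mscale (NngNum ci0) pf D.
  apply: product_measure_unique => // U V mU mV.
  rewrite -[RHS]cancelC /mscale /= /pushforward /mrestr /=.
  by rewrite -H.
rewrite prodE /mscale /= /pushforward /mrestr /=.
by rewrite muleC muleA -{1}(fineK fC) -EFinM divff ?mul1e // gt_eqF.
Qed.

(** Induction on [n]: the next partial sum is a function of the pair formed by the current sum and
    [X n], to which [joint_law] applies. *)
Lemma partial_sum_indep (X : nat -> {RV P >-> R}) : mutually_independent X ->
  forall n (s : {fset nat}) (B : nat -> set R) (A : set R),
  (forall i, measurable (B i)) -> (forall i, i \in s -> (n <= i)%N) -> measurable A ->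
  P ((fun t => \sum_(i < n) X i t)%R @^-1` A `&` \bigcap_(i in [set` s]) (X i @^-1` B i)) =
  P ((fun t => \sum_(i < n) X i t)%R @^-1` A) * P (\bigcap_(i in [set` s]) (X i @^-1` B i)).
Proof.
move=> Xind n; elim: n => [|n IH] s B A mB sn mA.
  rewrite (_ : (fun t => \sum_(i < 0) X i t)%R = cst 0%R); last first.
    by apply/funext => t; rewrite big_ord0.
  rewrite preimage_cst; case: ifPn => _; first by rewrite setTI probability_setT mul1e.
  by rewrite set0I measure0 mul0e.
have mS m : measurable_fun setT (fun t => \sum_(i < m) X i t)%R.
  by apply: measurable_sum => i; exact: measurable_funPT.
pose S : {RV P >-> R} := mfun_Sub (mem_set (mS n)).
have mXB i E : measurable E -> measurable (X i @^-1` E).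
  by move=> mE; rewrite -[Z in measurable Z]setTI; exact: measurable_funPT.
pose C := \bigcap_(i in [set` s]) (X i @^-1` B i).
have mC : measurable C.
  by apply: fin_bigcap_measurable => // i _; exact: mXB.
pose D := (fun z : R * R => (z.1 + z.2)%R) @^-1` A.
have mD : measurable D.
  rewrite -[Z in measurable Z]setTI; apply: measurable_funD => //.
have split (U V : set R) (s' : {fset nat}) : measurable U -> measurable V ->
    (forall i, i \in s' -> (n < i)%N) ->
    P (S @^-1` U `&` X n @^-1` V `&` \bigcap_(i in [set` s']) (X i @^-1` B i)) =
    P (S @^-1` U) * P (X n @^-1` V) * P (\bigcap_(i in [set` s']) (X i @^-1` B i)).
  move=> mU mV s'n.
  have ns' : n \notin s' by apply/negP => /s'n; rewrite ltnn.
  (* Overriding [B] at [n] places the event on [X n] inside the finite intersection, so the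
     induction hypothesis covers it. *)
  pose B' i := if i == n then V else B i.
  have mB' i : measurable (B' i) by rewrite /B'; case: ifP.
  have capE : \bigcap_(i in [set` (n |` s')%fset]) (X i @^-1` B' i) =
      X n @^-1` V `&` \bigcap_(i in [set` s']) (X i @^-1` B i).
    apply/seteqP; split=> [t H|t [Ht H] i /=].
      split=> [|i /= is'].
        by have := H n; rewrite /B' /= eqxx; apply; rewrite !inE eqxx.
      have := H i; rewrite /B' /=; case: eqP => [e|_]; first by rewrite -e is' in ns'.
      by apply; rewrite !inE is' orbT.
    rewrite !inE /B'; case: eqP => [->//|_ /= is']; exact: H.
  rewrite -setIA -capE IH //; last first.
    by move=> i; rewrite !inE => /predU1P[->//|/s'n/ltnW].
  rewrite (Xind _ B' mB') big_fsetU1 //= /B' eqxx muleA; congr (_ * _ * _).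
  rewrite (Xind _ B mB) big_seq [RHS]big_seq; apply: eq_bigr => i is'.
  by case: eqP => // e; rewrite e (negPf ns') in is'.
(* The joint law is used with the event [C] and with the full space; comparing the two gives the
   factorization. *)
have J1 := @joint_law S (X n) C mC (fun U V mU mV => split U V s mU mV sn) D mD.
have J0 := @joint_law S (X n) setT measurableT _ D mD.
have DE : (fun t => (S t, X n t)) @^-1` D = (fun t => \sum_(i < n.+1) X i t)%R @^-1` A.
  by apply/seteqP; split => t /=; rewrite /D /= big_ord_recr.
rewrite -DE J1; congr (_ * _).
rewrite -[RHS]mule1 -(@probability_setT _ _ _ P) -[LHS]mule1 -{1}(@probability_setT _ _ _ P).
rewrite -J0 ?setIT ?probability_setT ?mule1 // => U V mU mV.
have := split U V fset0 mU mV; rewrite (_ : [set` fset0] = set0) ?bigcap_set0; first by rewrite probability_setT; apply => i; rewrite inE.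
by apply/seteqP; split => i //=; rewrite inE.
Qed.

End independence.

Section density_of_sums.
Context d (T : measurableType d) (R : realType) (P : probability T R).
Local Notation mu := (std_normal R).

(* [R] and [measurableTypeR R] carry the same sigma-algebra under different
   displays, so the law is transported before comparing it with [mu]. *)
Lemma ge0_integral_law (Y : {RV P >-> R}) (p : R -> R) (f : R -> \bar R) :
  measurable_fun setT p -> (forall x, 0 <= p x) -> has_density P Y p ->
  measurable_fun setT f -> (forall x, 0 <= f x)%E ->
  (\int[distribution P Y]_y f y = \int[mu]_y (f y * (p y)%:E))%E.
Proof.
move=> mp p0 dY mf f0.
have mY : measurable_fun setT (Y : T -> measurableTypeR R) by exact: (measurable_funPT Y).
pose Y' : {RV P >-> measurableTypeR R} := @mfun_Sub _ _ T (measurableTypeR R) Y (mem_set mY).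
rewrite ge0_integral_distribution //.
transitivity (\int[distribution P Y']_y f y)%E.
  by rewrite ge0_integral_distribution.
exact: (@ge0_integral_density _ _ _ (distribution P Y') mu p).
Qed.

(** By [gmean_rot] the value is a Gaussian average of a product of two nonnegative polynomials. *)
Lemma hexp_convolution_ge0 (a b : R) (p q : {poly R}) : a ^+ 2 + b ^+ 2 = 1 ->
  (forall x, 0 <= (hexp p).[x]) -> (forall x, 0 <= (hexp q).[x]) ->
  forall z, 0 <= (hexp (pdilate a p * pdilate b q)).[z].
Proof.
move=> ab p0 q0 z; rewrite -lee_fin -gmean_rot // -integral_horner.
by apply: integral_ge0 => x _; rewrite lee_fin hornerM !horner_comp mulr_ge0.
Qed.

(** The integral of the product density over [a y + b x] in [A] is taken in orthogonal coordinates
    [(z, v)] with [z = a y + b x]; the inner integral over [v] is evaluated by [gmean_rot]. *)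
Lemma has_density_combination (Y X : {RV P >-> R}) (a b : R) (p q : {poly R}) :
  (forall U V, measurable U -> measurable V ->
    P (Y @^-1` U `&` X @^-1` V) = P (Y @^-1` U) * P (X @^-1` V))%E ->
  a ^+ 2 + b ^+ 2 = 1 -> 0 < b ->
  (forall x, 0 <= (hexp p).[x]) -> (forall x, 0 <= (hexp q).[x]) ->
  has_density P Y (horner (hexp p)) -> has_density P X (horner (hexp q)) ->
  has_density P (fun t => a * Y t + b * X t)
    (horner (hexp (pdilate a p * pdilate b q))).
Proof.
move=> ind ab b0 p0 q0 dY dX A mA.
pose L (z : R * R) := a * z.1 + b * z.2.
have mL : measurable_fun setT L.
  by apply: measurable_funD; apply: measurable_funM.
have mD : measurable (L @^-1` A) by rewrite -[Z in measurable Z]setTI; exact: mL.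
have := @joint_law _ _ _ P Y X setT measurableT _ _ mD.
rewrite probability_setT mule1 setIT => -> => [|U V mU mV]; last first.
  by rewrite ?probability_setT ?mule1 ?setIT ind.
pose I z : R := \1_A (L z).
have mI : measurable_fun setT I by apply: (measurableT_comp (measurable_indic mA) mL).
have I0 z : 0 <= I z by rewrite /I indicE.
pose p1 := hexp p; pose q1 := hexp q.
have mp1 : measurable_fun setT (horner p1) by exact: measurable_horner.
have mq1 : measurable_fun setT (horner q1) by exact: measurable_horner.
pose F (z : R * R) : \bar R := (I z * (p1.[z.1] * q1.[z.2]))%:E.
have F0 z : (0 <= F z)%E by rewrite lee_fin !mulr_ge0.
have mF : measurable_fun setT F.
  apply/measurable_EFinP; apply: measurable_funM => //; apply: measurable_funM.
    exact: (measurableT_comp mp1).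
  exact: (measurableT_comp mq1).
have mI1 y : measurable_fun setT (fun x => (I (y, x))%:E).
  by apply/measurable_EFinP; apply: (measurableT_comp mI); exact: measurable_pair1.
transitivity (\int[mu]_y \int[mu]_x F (y, x))%E.
  transitivity (\int[distribution P Y \x distribution P X]_z (I z)%:E)%E.
    rewrite (_ : (fun z => (I z)%:E) = (fun z => (\1_(L @^-1` A) z)%:E)) //.
    by rewrite integral_indic // setIT.
  rewrite fubini_tonelli1 //; last exact/measurable_EFinP.
  rewrite (ge0_integral_law mp1 p0 dY); last 2 first.
  - by apply: measurable_fun_fubini_tonelli_F => //; exact/measurable_EFinP.
  - by move=> y; apply: integral_ge0 => x _; rewrite lee_fin.
  apply: eq_integral => y _; rewrite /fubini_F.
  rewrite (ge0_integral_law mq1 q0 dX) //.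
  rewrite -ge0_integralZr //.
  - by apply: eq_integral => x _; rewrite -!EFinM /F /=; congr (_%:E); ring.
  - apply: emeasurable_funM; first exact: mI1.
    by apply/measurable_EFinP; exact: mq1.
  - by move=> x _; rewrite mule_ge0 // lee_fin ?q0.
  - by rewrite lee_fin p0.
  - by move=> x; rewrite lee_fin.
rewrite (std_normal_rotation ab b0 mF F0) [RHS]integral_mkcond.
apply: eq_integral => z _; rewrite patchE.
(* The indicator depends on [z] alone, so it leaves the inner integral. *)
transitivity ((\1_A z)%:E * \int[mu]_v ((p1 \Po ((a * z)%:P + b *: 'X)) *
    (q1 \Po ((b * z)%:P + (- a) *: 'X))).[v]%:E)%E; last first.
  rewrite integral_horner gmean_rot // indicE.
  by case: (z \in A); rewrite ?mul1e ?mul0e.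
rewrite -integralZl //; last exact: integrable_horner.
apply: eq_integral => v _; rewrite /F /I /L /= -EFinM; congr (_%:E).
have -> : a * (a * z + b * v) + b * (b * z - a * v) = z.
  by transitivity ((a ^+ 2 + b ^+ 2) * z); [ring|rewrite ab mul1r].
by rewrite hornerM !horner_comp !hornerD !hornerZ !hornerC !hornerX mulNr.
Qed.

End density_of_sums.

(** * Densities and chi-square distances of normalized sums *)

Section chi2_of_sums.
Context {R : realType}.
Local Notation mu := (std_normal R).

Lemma gmean_hexp (p : {poly R}) : gmean (hexp p) = p`_0.
Proof. by have := gmean_hermh 0 p; rewrite !mul1r. Qed.

(** Matching moments up to [r] give [herm i] the same mean under the density as under [mu], which is
    0 for [0 < i <= r] by orthogonality to [herm 0]. *)
Lemma density_coefs (r : nat) (g : {poly R}) :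
  prob_density (horner (hexp g)) -> same_moments r (horner (hexp g)) ->
  g`_0 = 1 /\ forall i, (0 < i < r.+1)%N -> g`_i = 0.
Proof.
move=> [_ _ int1] mom.
have g0 : gmean (hexp g) = 1 by apply: EFin_inj; rewrite -integral_horner.
split=> [|i /andP[i0 ir]]; first by rewrite -gmean_hexp.
have mX m : (m <= r)%N -> gmean ('X^m * hexp g) = gmean 'X^m.
  case: m => [|m] mr; first by rewrite mul1r g0 gmean1.
  apply: EFin_inj; rewrite -!integral_horner.
  have := mom m.+1 mr => e; transitivity (\int[mu]_x (x ^+ m.+1 * (hexp g).[x])%:E)%E.
    by apply: eq_integral => x _; rewrite hornerM hornerXn.
  by rewrite e; apply: eq_integral => x _; rewrite hornerXn.
have key : gmean (herm i * hexp g) = gmean (herm i).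
  rewrite -[herm i]coefK poly_def mulr_suml !gmean_sum.
  apply: eq_bigr => k _; rewrite -scalerAl !gmeanZ mX //.
  by rewrite -ltnS (leq_trans (ltn_ord k)) // (herm_monic_size i).2.
have : gmean (herm i * hexp g) = 0.
  by rewrite key -[herm i]mulr1 -[1]/(herm 0) gmean_herm2 gtn_eqF // mul0r.
rewrite gmean_hermh => /eqP; rewrite mulf_eq0 pnatr_eq0 -leqn0 leqNgt fact_gt0 /=.
by move/eqP.
Qed.

(** Equal integrals over all measurable sets force [h] to equal the polynomial density almost
    everywhere; Parseval then applies. *)
Lemma chi2_hexp (p : {poly R}) (h : R -> R) : p`_0 = 1 -> prob_density h ->
  (forall A : set R, measurable A ->
    \int[mu]_(x in A) (h x)%:E = \int[mu]_(x in A) ((hexp p).[x])%:E)%E ->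
  chi2 h = (Num.sqrt (\sum_(i < size (p - 1)) i`!%:R * ((p - 1)`_i) ^+ 2))%:E.
Proof.
move=> p0 [mh h0 int1] hE.
have mhE : measurable_fun setT (EFin \o h) by exact/measurable_EFinP.
have ih : mu.-integrable setT (EFin \o h).
  apply/integrableP; split => //.
  under eq_integral do rewrite /= ger0_norm //.
  by rewrite int1 ltry.
have mp : measurable_fun setT (horner (hexp p)) by exact: measurable_horner.
have ae : ae_eq mu setT (EFin \o h) (EFin \o horner (hexp p)).
  apply: integral_ae_eq => //; first exact/measurable_EFinP.
  by move=> E _ mE; exact: hE.
have sqE : (\int[mu]_x ((h x - 1) ^+ 2)%:E =
    \int[mu]_x (((hexp (p - 1)) * hexp (p - 1)).[x])%:E)%E.
  apply: ae_eq_integral => //.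
  - apply/measurable_EFinP; apply: measurable_funX; apply: measurable_funB => //.
  - by apply/measurable_EFinP; exact: measurable_horner.
  - apply: filterS ae => x /= + _ => /(_ I) [->].
    have -> : hexp (p - 1) = hexp p - 1 by rewrite -[in RHS]hexp1; exact: raddfB.
    by rewrite hornerM hornerD hornerN hornerC expr2.
rewrite /chi2 sqE integral_horner gmean_hexp2 poweR_EFin powR12_sqrt //.
by apply: sumr_ge0 => i _; rewrite mulr_ge0 // -expr2 sqr_ge0.
Qed.

(** Induction through [Y_(n+1) = sqrt (n / (n + 1)) Y_n + X / sqrt (n + 1)], with [X] the next
    variable; the squares of the two weights add up to 1. *)
Lemma has_density_normalized_sum d (T : measurableType d) (P : probability T R)
    (X : nat -> {RV P >-> R}) (g : nat -> {poly R}) (n : nat) :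
  mutually_independent X -> (forall i x, 0 <= (hexp (g i)).[x]) ->
  (forall i, has_density P (X i) (horner (hexp (g i)))) -> (0 < n)%N ->
  let p := pdilate (Num.sqrt n%:R)^-1 (\prod_(i < n) g i) in
  (forall x, 0 <= (hexp p).[x]) /\ has_density P (normalized_sum X n) (horner (hexp p)).
Proof.
move=> Xind g0 dX; case: n => // n _ /=; elim: n => [|n [p0 dY]].
  have -> : pdilate (Num.sqrt 1)^-1 (\prod_(i < 1) g i) = g 0%N.
    by apply/polyP => i; rewrite coef_pdilate sqrtr1 invr1 expr1n mul1r big_ord1.
  split=> //; rewrite (_ : normalized_sum X 1 = X 0%N) //.
  by apply/funext => t; rewrite /normalized_sum sqrtr1 invr1 mul1r big_ord1.
set s : R := Num.sqrt n.+1%:R in p0 dY; set s' : R := Num.sqrt n.+2%:R.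
have s0 : 0 < s by rewrite sqrtr_gt0 ltr0n.
have s'0 : 0 < s' by rewrite sqrtr_gt0 ltr0n.
have ab : (s / s') ^+ 2 + s'^-1 ^+ 2 = 1.
  rewrite exprMn exprVn !sqr_sqrtr // -[X in _ + X]mul1r -mulrDl natr1 divff //.
have b0 : 0 < s'^-1 by rewrite invr_gt0.
have mS : measurable_fun setT (normalized_sum X n.+1).
  apply: measurable_funM => //; apply: measurable_sum => i; exact: measurable_funPT.
pose Y : {RV P >-> R} := mfun_Sub (mem_set mS).
have ind U V : measurable U -> measurable V ->
    (P (Y @^-1` U `&` X n.+1 @^-1` V) = P (Y @^-1` U) * P (X n.+1 @^-1` V))%E.
  move=> mU mV.
  (* An event on the normalized sum becomes one on the bare partial sum, as [partial_sum_indep]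
     requires. *)
  have mA : measurable ((fun x => s^-1 * x) @^-1` U).
    rewrite -[Z in measurable Z]setTI; exact: (measurable_funM (measurable_cst _) (@measurable_id _ _ _)).
  have in1 i : i \in [fset n.+1]%fset -> (n.+1 <= i)%N by rewrite inE => /eqP ->.
  have := partial_sum_indep Xind (fun=> mV) in1 mA.
  rewrite (_ : \bigcap_(i in [set` [fset n.+1]%fset]) _ = X n.+1 @^-1` V) //.
  apply/seteqP; split => [t /(_ n.+1)|t Vt i /=].
    by apply; rewrite /= inE.
  by rewrite inE => /eqP ->.
have pE : pdilate s'^-1 (\prod_(i < n.+2) g i) =
    pdilate (s / s') (pdilate s^-1 (\prod_(i < n.+1) g i)) * pdilate s'^-1 (g n.+1).
  rewrite big_ord_recr pdilateM pdilate_dilate; congr (pdilate _ _ * _).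
  by rewrite mulrAC divff ?gt_eqF // mul1r.
rewrite pE; split; first exact: hexp_convolution_ge0.
have -> : normalized_sum X n.+2 = fun t => s / s' * Y t + s'^-1 * X n.+1 t.
  apply/funext => t; rewrite /normalized_sum /Y /= /normalized_sum big_ord_recr /=.
  by rewrite -/s -/s' mulrDr; congr (_ + _); field; rewrite !gt_eqF.
by apply: has_density_combination; rewrite ?g0.
Qed.

End chi2_of_sums.

(** * The rate of convergence in chi-square distance *)

Theorem mainTheorem3 (R : realType) (r : nat) (hr : (2 <= r)%N)
  (J : finType) (hJ : (0 < #|J|)%N) (phi : J -> {poly R})
  (phi_density : forall j, prob_density (horner (phi j)))
  (phi_moments : forall j, same_moments r (horner (phi j)))
  (phi_H : forall j, hypothesis_H r.+1 (phi j))
  (d : measure_display) (T : measurableType d) (P : probability T R)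
  (X : nat -> {RV P >-> R})
  (X_indep : mutually_independent X)
  (X_law : forall i, exists j, has_density P (X i) (horner (phi j)))
  (f : nat -> R -> R)
  (f_density : forall n, (1 <= n)%N ->
     prob_density (f n) /\ has_density P (normalized_sum X n) (f n)) :
  (limn_esup (fun n => (n%:R `^ ((r%:R - 1) / 2))%:E * chi2 (f n)) < +oo)%E.
Proof.
have /choice[g Hg] : forall j, exists g : {poly R}, size g = size (phi j) /\ hexp g = phi j.
  by move=> j; have [g ? ?] := hexp_surj (phi j); exists g.
have gc j : (g j)`_0 = 1 /\ forall i, (0 < i < r.+1)%N -> (g j)`_i = 0.
  by apply: density_coefs; rewrite (Hg j).2.
have gexp j t : 0 <= t -> (majorant (g j)).[t] <= expR (t ^+ 2 / 4).
  apply: (@majorant_le_expR R r.+1 (phi j)) => //; first exact: (Hg j).1.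
  - exact: (gc j).1.
  - exact: (gc j).2.
  - by move=> k; rewrite -(Hg j).2 hermite_coef_hexp.
have [C HC] := weighted_coef_sum_bound (leqW hr) (fun j => (gc j).1) (fun j => (gc j).2) gexp.
have /choice[s Hs] := X_law.
have chi2_le n : (0 < n)%N ->
    ((n%:R `^ ((r%:R - 1) / 2))%:E * chi2 (f n) <= (Num.sqrt C)%:E)%E.
  move=> n0; have [fd fY] := f_density n n0.
  have N0 : 0 < n%:R :> R by rewrite ltr0n.
  have g0 i x : 0 <= (hexp (g (s i))).[x].
    by rewrite (Hg _).2; have [_ ? _] := phi_density (s i).
  have dX i : has_density P (X i) (horner (hexp (g (s i)))) by rewrite (Hg _).2.
  have [p0 pd] := has_density_normalized_sum X_indep g0 dX n0.
  set q := \prod_(i < n) g (s i) in p0 pd *; set p := pdilate _ q in p0 pd *.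
  have q0 : q`_0 = 1.
    rewrite -horner_coef0 horner_prod big1 // => i _.
    by rewrite horner_coef0 (gc _).1.
  have pc i : p`_i ^+ 2 = q`_i ^+ 2 / n%:R ^+ i.
    rewrite coef_pdilate exprMn -exprM mulnC exprM exprVn sqr_sqrtr ?ler0n //.
    by rewrite exprVn mulrC.
  have pc0 : p`_0 = 1 by rewrite coef_pdilate mul1r.
  rewrite (chi2_hexp pc0 fd) => [|A mA]; last by rewrite -fY // -pd.
  set S := \sum_(i < _) _.
  (* Subtracting 1 removes the constant term, so the sum starts at order 1; dilation by [1 / sqrt n]
     yields the weights [1 / n ^ i]. *)
  have SC : S <= C / n%:R ^+ (r.+1 - 2).
    rewrite (le_trans _ (HC n s (size (p - 1)) n0)) // [leRHS]big_mkcond.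
    rewrite le_eqVlt; apply/orP; left; apply/eqP; apply: eq_bigr => i _.
    rewrite coefB coef1; case: (posnP i) => [->|i0].
      by rewrite pc0 subrr expr0n mulr0.
    by rewrite subr0 pc mulrA.
  have S0 : 0 <= S by apply: sumr_ge0 => i _; rewrite mulr_ge0 ?sqr_ge0.
  rewrite -EFinM lee_fin; set w := _ `^ _.
  (* The square of the normalization is [n ^ (r - 1)], exactly the decay [n ^ (K - 2)] of the sum
     for [K = r + 1]. *)
  have w2 : w ^+ 2 = n%:R ^+ (r.+1 - 2).
    rewrite /w -powR_mulrn ?powR_ge0 // -powRrM divfK // -powR_mulrn ?ler0n //.
    by congr (_ `^ _); rewrite subSS natrB // (leq_trans _ hr).
  rewrite -[w]ger0_norm ?powR_ge0 // -sqrtr_sqr -sqrtrM ?sqr_ge0 // ler_wsqrtr //.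
  by rewrite w2 mulrC -ler_pdivlMr // exprn_gt0.
apply: (@le_lt_trans _ _ (Num.sqrt C)%:E); last exact: ltry.
rewrite /limn_esup /limf_esup.
(* The upper limit is at most the supremum over [n >= 1], a range that excludes [n = 0], for which
   no density is assumed. *)
apply: (@le_trans _ _ (ereal_sup ((fun n => (n%:R `^ ((r%:R - 1) / 2))%:E * chi2 (f n)) @`
  [set n | (1 <= n)%N]))%E).
  by apply: ereal_inf_lbound; exists [set n | (1 <= n)%N] => //; exists 1%N.
by apply: ge_ereal_sup => _ [n n1 <-]; exact: chi2_le.
Qed.
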